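(* For every integer $m\ge 1$ there is $\varepsilon_0>0$ (depending only on $m$) such that for every $0<\varepsilon<\varepsilon_0$ the following holds. Let $X$ be a compact Hausdorff space, $\{U_\alpha\}_{\alpha\in\Lambda}$ a finite open covering of $X$ with $|\Lambda|=m$, and $(g^+_{\alpha\beta},g^-_{\alpha\beta})$ an $\varepsilon$-generalized pair of cocycles with values in $\mathrm U(N)$, for some $N\ge 1$. Then the matrix-valued function $Q$ defined from this pair (and from a partition of unity subordinated to the covering) is an almost projection, i.e. $\|Q-Q^2\|<\frac14$, and it determines a vector bundle over $X$ up to isomorphism: there is a projection $P\in C(X,M_{2mN})$ with $\|Q-P\|<\frac12$, and the isomorphism class of the vector bundle over $X$ given by the image of $P$ depends neither on the choice of such a $P$ nor on the choice of the partition of unity used to define $Q$.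
   Context: $\mathrm U(N)$ is the unitary group of an $N$-dimensional Hermitian space. $X$ is a compact Hausdorff space, $\{U_\alpha\}_{\alpha\in\Lambda}$ is a finite open covering of $X$, $m=|\Lambda|$. Let $g^{\pm}_{\alpha\beta}:U_\alpha\cap U_\beta\to \mathrm U(N)$ be continuous maps with $g^{\pm}_{\alpha\beta}=(g^{\pm}_{\beta\alpha})^{-1}$ for all $\alpha,\beta\in\Lambda$. For $\varepsilon>0$, they are called an $\varepsilon$-generalized pair of cocycles if $$\|(g^{+}_{\alpha\beta}(x)g^{+}_{\beta\gamma}(x)-g^{+}_{\alpha\gamma}(x))(g^+_{\gamma\delta}(x)-g^-_{\gamma\delta}(x))\|<\varepsilon,\qquad \|(g^{-}_{\alpha\beta}(x)g^{-}_{\beta\gamma}(x)-g^{-}_{\alpha\gamma}(x))(g^+_{\gamma\delta}(x)-g^-_{\gamma\delta}(x))\|<\varepsilon$$ for all $\alpha,\beta,\gamma,\delta\in\Lambda$ and every $x\in X$ at which the maps involved are defined (operator norm). Partition of unity: continuous functions $\varphi_\alpha:X\to[0,1]$, $\alpha\in\Lambda$, with $\operatorname{supp}\varphi_\alpha\subset U_\alpha$ and $\sum_{\beta}\varphi_\beta^2(x)=1$ for all $x\in X$. Put $A_\pm=[(A_\pm)_{\alpha\beta}]_{\alpha,\beta\in\Lambda}$, $(A_\pm)_{\alpha\beta}(x)=\varphi_\alpha(x)\varphi_\beta(x)g^\pm_{\alpha\beta}(x)$ (understood as $0$ when $x\notin U_\alpha\cap U_\beta$); these are selfadjoint elements of $C(X,M_{mN})$,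 where $M_k$ denotes complex $k\times k$ matrices. Let $f(t)=0$ for $t\le 0$, $f(t)=t$ for $0\le t\le1$, $f(t)=1$ for $t\ge1$, and $B_\pm=f(A_\pm)$ (functional calculus). Let $\kappa(t)=\sqrt{t-t^2}$ on $[0,1]$ and $$Q=\begin{pmatrix}1-B_+&\kappa(B_+)\\ \kappa(B_+)&B_-\end{pmatrix}\in C(X,M_{2mN}).$$ Norms of matrix-valued functions on $X$ are suprema over $X$ of the operator norm. A projection $P\in C(X,M_k)$ means $P=P^*=P^2$; its image is a subbundle of the trivial bundle $X\times\mathbb C^k$. *)

(* Defs.v *)
From HB Require Import structures.
From mathcomp Require Import all_boot all_order all_algebra.
From mathcomp Require Import complex.
From mathcomp Require Import all_classical all_reals all_analysis.

Set Implicit Arguments.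
Unset Strict Implicit.
Unset Printing Implicit Defensive.

Import Order.TTheory GRing.Theory Num.Theory.
Import numFieldNormedType.Exports.
Local Open Scope classical_set_scope.
Local Open Scope sesquilinear_scope.
Local Open Scope complex_scope.
Local Open Scope ring_scope.

(* The usual topology of the complex numbers, given by the modulus; the
   library then provides 'M[R[i]]_(p, q) with the product topology, which is
   also the topology of the operator norm. *)
#[non_forgetful_inheritance]
HB.instance Definition _ (R : realType) :=
  NormedModule.copy R[i] (R[i])^o.

Definition l2norm (R : realType) (n : nat) (v : 'cV[R[i]]_n) : R :=
  Num.sqrt (\sum_(i < n) complex.Re `|v i 0| ^+ 2).

Definition opnorm (R : realType) (n : nat) (A : 'M[R[i]]_n) : R :=
  sup [set l2norm (A *m v) | v in [set v : 'cV[R[i]]_n | l2norm v <= 1]].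

(* Extended-real valued, so that an unbounded F has norm +oo; the element 0
   matters only for empty X. *)
Definition supnorm (R : realType) (X : Type) (n : nat)
    (F : X -> 'M[R[i]]_n) : \bar R :=
  ereal_sup (0%E |` range (fun x => (opnorm (F x))%:E)).

(* Functional calculus h(A) for a Hermitian matrix A and a function h on the
   real line: A = V^-1 diag(d) V with V = spectralmx A unitary and
   d = spectral_diag A real. In C(X, M_n) it is applied at each point of X. *)
Definition fun_calc (R : realType) (n : nat) (h : R -> R)
    (A : 'M[R[i]]_n) : 'M[R[i]]_n :=
  invmx (spectralmx A)
    *m diag_mx (map_mx (fun z => (h (complex.Re z))%:C) (spectral_diag A))
    *m spectralmx A.

Definition open_covering (X : topologicalType) (L : finType)
    (U : L -> set X) : Prop :=
  (forall a, open (U a)) /\ \bigcup_a U a = [set: X].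

(* Maps U_a \cap U_b -> U(N) are represented by total functions on X, of which
   only the values on U_a \cap U_b are constrained or used. *)
Definition transition_maps (R : realType) (X : topologicalType) (L : finType)
    (U : L -> set X) (N : nat) (g : L -> L -> X -> 'M[R[i]]_N) : Prop :=
  [/\ forall a b, {within U a `&` U b, continuous (g a b)},
      forall a b x, (U a `&` U b) x -> g a b x \is unitarymx &
      forall a b x, (U a `&` U b) x -> g a b x = invmx (g b a x)].

Definition generalized_pair (R : realType) (eps : R) (X : topologicalType)
    (L : finType) (U : L -> set X) (N : nat)
    (gp gm : L -> L -> X -> 'M[R[i]]_N) : Prop :=
  [/\ transition_maps U gp,
      transition_maps U gm &
      forall a b c d x, U a x -> U b x -> U c x -> U d x ->
        opnorm ((gp a b x *m gp b c x - gp a c x)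
                  *m (gp c d x - gm c d x)) < eps /\
        opnorm ((gm a b x *m gm b c x - gm a c x)
                  *m (gp c d x - gm c d x)) < eps].

Definition partition_of_unity (R : realType) (X : topologicalType)
    (L : finType) (U : L -> set X) (phi : L -> X -> R) : Prop :=
  [/\ forall a, continuous (phi a),
      forall a x, 0 <= phi a x <= 1,
      forall a, closure [set x | phi a x != 0] `<=` U a &
      forall x, \sum_a phi a x ^+ 2 = 1].

(* M_{mN}, with m = #|L|, as m x m block matrices with blocks in M_N; the
   elements of L are numbered by enum_val. *)
Definition bdim (L : finType) (N : nat) : nat := (\sum_(i < #|L|) N)%N.

Definition Amx (R : realType) (X : topologicalType) (L : finType)
    (U : L -> set X) (phi : L -> X -> R) (N : nat)
    (g : L -> L -> X -> 'M[R[i]]_N) (x : X) : 'M[R[i]]_(bdim L N) :=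
  let entry (a b : L) : 'M[R[i]]_N :=
    if x \in U a `&` U b then (phi a x * phi b x)%:C *: g a b x else 0 in
  \mxblock_(i < #|L|, j < #|L|) entry (enum_val i) (enum_val j).

Definition cutoff (R : realType) (t : R) : R :=
  if t <= 0 then 0 else if t <= 1 then t else 1.

(* Num.sqrt vanishes on negative numbers; only values on [0, 1] are used. *)
Definition kappa (R : realType) (t : R) : R := Num.sqrt (t - t ^+ 2).

Definition Bmx (R : realType) (X : topologicalType) (L : finType)
    (U : L -> set X) (phi : L -> X -> R) (N : nat)
    (g : L -> L -> X -> 'M[R[i]]_N) (x : X) : 'M[R[i]]_(bdim L N) :=
  fun_calc (@cutoff R) (Amx U phi g x).

Definition Qmx (R : realType) (X : topologicalType) (L : finType)
    (U : L -> set X) (phi : L -> X -> R) (N : nat)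
    (gp gm : L -> L -> X -> 'M[R[i]]_N) (x : X) :
    'M[R[i]]_(bdim L N + bdim L N) :=
  let Bp := Bmx U phi gp x in
  let Bm := Bmx U phi gm x in
  block_mx (1%:M - Bp)                (fun_calc (@kappa R) Bp)
           (fun_calc (@kappa R) Bp)   Bm.

Definition almost_projection (R : realType) (X : topologicalType) (n : nat)
    (F : X -> 'M[R[i]]_n) : Prop :=
  continuous F /\ (supnorm (fun x => F x - F x *m F x)%R < (1 / 4)%:E)%E.

Definition projection (R : realType) (X : topologicalType) (n : nat)
    (P : X -> 'M[R[i]]_n) : Prop :=
  continuous P /\ forall x, P x = (P x)^t* /\ P x = P x *m P x.

(* Total space of the image of P inside X x C^n, with the subspace topology
   and the first projection as bundle map. *)
Definition image_bundle (R : realType) (X : topologicalType) (n : nat)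
    (P : X -> 'M[R[i]]_n) : set (X * 'cV[R[i]]_n) :=
  [set p | exists w : 'cV[R[i]]_n, p.2 = P p.1 *m w].

(* Isomorphism over X of subbundles E, E' of trivial bundles: a homeomorphism
   F of the total spaces, with inverse G, that covers the identity of X and is
   linear on fibres. *)
Definition bundle_iso (R : realType) (X : topologicalType) (n n' : nat)
    (E : set (X * 'cV[R[i]]_n)) (E' : set (X * 'cV[R[i]]_n')) : Prop :=
  exists (F : X * 'cV[R[i]]_n -> X * 'cV[R[i]]_n')
         (G : X * 'cV[R[i]]_n' -> X * 'cV[R[i]]_n),
  [/\ {within E, continuous F} /\ {within E', continuous G},
      forall p, E p -> E' (F p) /\ G (F p) = p,
      forall q, E' q -> E (G q) /\ F (G q) = q,
      forall p, E p -> (F p).1 = p.1 &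
      forall x u v (c : R[i]), E (x, u) -> E (x, v) ->
        (F (x, c *: u + v)).2 = c *: (F (x, u)).2 + (F (x, v)).2].

(* Main.v *)
Require Import Defs.
From mathcomp Require Import all_boot all_order all_algebra.
From mathcomp Require Import perm complex.
From mathcomp Require Import all_classical all_reals all_analysis.
From mathcomp Require Import ring lra.
Import Order.TTheory GRing.Theory Num.Theory.
Import numFieldNormedType.Exports.
Local Open Scope classical_set_scope.
Local Open Scope sesquilinear_scope.
Local Open Scope complex_scope.
Local Open Scope ring_scope.
Set Implicit Arguments.
Unset Strict Implicit.
Unset Printing Implicit Defensive.

(** Fix a point of the space.  Since phi_a vanishes outside U_a, the matrices
    A_+ and A_- have blocks phi_a phi_b g_ab.  They are Hermitian contractions,
    and for both signs s each block of (A_s^2 - A_s)(A_+ - A_-) is phi_a phi_d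
    times a convex combination, with weights phi_b^2 phi_c^2, of the matrices
    which are supposed to be small; hence this product has norm at most epsilon
    in every dimension ([Amx_defect]).

    For numbers, (a^2 - a)(a - b) = 0 = (b^2 - b)(a - b) says that a = b or that
    both lie in {0, 1}.  For Hermitian contractions the same holds
    approximately: if c commutes with a and c (a - b) is small, then
    c (F a - F b) is small, for every function F that sums, products, square
    roots and uniform limits build from the identity ([stable]).  With p = f(A_+),
    q = f(A_-), k = kappa(p), the blocks of Q - Q^2 are 0, k (p - q), its
    adjoint and (q - q^2) - (p - p^2).  The second one is small by stability with
    c = k.  For the last one, let u = f - f^2: by stability u(A_+) and u(A_-) both
    annihilate u(A_+) - u(A_-) = (p - p^2) - (q - q^2) up to a small error, so the
    square of this Hermitian difference is small ([almost_projection_blocks]).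

    All moduli are uniform over an abstract class of algebras with a norm and a
    functional calculus ([opAlgebra]), hence over all matrix sizes.  With the
    unit for c, stability is uniform continuity of the functional calculus; it
    makes Q continuous on the space, and also the projection P obtained by
    rounding the spectrum of Q to {0, 1} ([rounded]), which stays at distance at
    most 1/4 from Q.

    Two projections at distance less than 1 are conjugate by the invertible
    matrix P' P + (1 - P')(1 - P), which depends continuously on both
    ([conjugate_close]), and conjugate projections have isomorphic images
    ([conjugate_bundle_iso]).  This makes the class independent of P.  Two
    partitions of unity phi, psi are joined by ((1 - s) phi^2 + s psi^2)^(1/2);
    along this path Q moves uniformly continuously in s, at all points of the
    space at once, so that finitely many steps link the two rounded projections
    ([rounded_conjugate]). *)

(** * The operator norm of a complex matrix *)

Section OperatorNorm.
Variable R : realType.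
Local Notation C := R[i].

Lemma le_sqrt_sqr (x c : R) : 0 <= x -> 0 <= c -> x <= Num.sqrt c -> x ^+ 2 <= c.
Proof.
move=> x0 c0 xc; rewrite -(sqr_sqrtr c0).
by rewrite ler_sqr ?nnegrE ?sqrtr_ge0.
Qed.

Lemma le_sqrtM (x y c : R) : 0 <= x -> 0 <= y -> 0 <= c ->
  x ^+ 2 <= c * y ^+ 2 -> x <= Num.sqrt c * y.
Proof.
move=> x0 y0 c0 H; rewrite -ler_sqr ?nnegrE ?mulr_ge0 ?sqrtr_ge0 //.
by rewrite exprMn (sqr_sqrtr c0).
Qed.

Lemma normCE (z : C) : `|z| = (complex.Re `|z|)%:C.
Proof. by rewrite normc_def. Qed.

Lemma Re_norm_ge0 (z : C) : 0 <= complex.Re `|z|.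
Proof. by rewrite -ler0c -normCE. Qed.

Lemma ReD (x y : C) : complex.Re (x + y) = complex.Re x + complex.Re y.
Proof. by case: x; case: y. Qed.

Lemma Re_sum (I : finType) (F : I -> C) :
  complex.Re (\sum_i F i) = \sum_i complex.Re (F i).
Proof. exact: (big_morph _ ReD (erefl _)). Qed.

Lemma Re_normX (z : C) : (complex.Re `|z| ^+ 2)%:C = z^* * z.
Proof. by rewrite rmorphXn /= -normCE normCK mulrC. Qed.

Definition cdot n (u v : 'cV[C]_n) : C := (u^t* *m v) 0 0.

Lemma l2norm_ge0 n (v : 'cV[C]_n) : 0 <= l2norm v.
Proof. exact: sqrtr_ge0. Qed.

Lemma l2norm_sqr n (v : 'cV[C]_n) :
  l2norm v ^+ 2 = \sum_(i < n) complex.Re `|v i 0| ^+ 2.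
Proof. by rewrite sqr_sqrtr// sumr_ge0// => i _; exact: sqr_ge0. Qed.

Lemma cdot_l2norm n (v : 'cV[C]_n) : cdot v v = (l2norm v ^+ 2)%:C.
Proof.
rewrite l2norm_sqr rmorph_sum /= /cdot mxE; apply: eq_bigr => i _.
by rewrite Re_normX !mxE.
Qed.

(** Transposed, this is the Cauchy-Schwarz inequality for row vectors. *)
Lemma Re_cdot_le n (u v : 'cV[C]_n) :
  complex.Re (cdot u v) <= l2norm u * l2norm v.
Proof.
have le : `|dotmx v^T u^T| ^+ 2 <= dotmx v^T v^T * dotmx u^T u^T.
  by have [] := CauchySchwarz (@dotmx C n) v^T u^T.
have E (x y : 'cV[C]_n) : dotmx y^T x^T = cdot x y.
  by rewrite dotmxE /cdot trmxK !mxE; apply: eq_bigr => i _; rewrite !mxE mulrC.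
rewrite !E !cdot_l2norm in le.
have H : (complex.Re `|cdot u v|) ^+ 2 <= (l2norm u * l2norm v) ^+ 2.
  rewrite -lecR rmorphXn /= -normCE exprMn mulrC rmorphM /=; exact: le.
rewrite ler_sqr ?nnegrE ?mulr_ge0 ?l2norm_ge0 // in H; last first.
  exact: Re_norm_ge0.
apply: le_trans H; rewrite -lecR -normCE.
by apply: le_trans (normc_ge_Re _); rewrite lecR ler_norm.
Qed.

Lemma l2normD n (u v : 'cV[C]_n) : l2norm (u + v) <= l2norm u + l2norm v.
Proof.
rewrite -ler_sqr ?nnegrE ?addr_ge0 ?l2norm_ge0 //.
have E : cdot (u + v) (u + v) = cdot u u + cdot u v + (cdot v u + cdot v v).
  rewrite /cdot (_ : (u + v)^t* = u^t* + v^t*).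
    rewrite mulmxDl (mulmxDr (u^t* )) (mulmxDr (v^t* )) mxE.
    by congr (_ + _); rewrite mxE.
  by rewrite linearD /= map_mxD.
have {E} := congr1 (@complex.Re R) E; rewrite !ReD !cdot_l2norm /= => ->.
have := Re_cdot_le u v; have := Re_cdot_le v u; rewrite sqrrD mulrC; lra.
Qed.

Lemma l2normZ n (c : C) (v : 'cV[C]_n) :
  l2norm (c *: v) = complex.Re `|c| * l2norm v.
Proof.
have c0 := Re_norm_ge0 c.
rewrite -[X in X * _](ger0_norm c0) -sqrtr_sqr -sqrtrM ?sqr_ge0 //.
rewrite /l2norm mulr_sumr; congr Num.sqrt; apply: eq_bigr => i _.
by rewrite mxE normrM normCE [`|v _ _|]normCE -rmorphM /= exprMn.
Qed.

#[local] Opaque l2norm.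

Lemma l2norm0 n : l2norm (0 : 'cV[C]_n) = 0.
Proof. by rewrite -[0 in LHS](scale0r (0 : 'cV[C]_n)) l2normZ normr0 mul0r. Qed.

Lemma l2norm_eq0 n (v : 'cV[C]_n) : l2norm v = 0 -> v = 0.
Proof.
move=> v0; apply/colP => i; rewrite mxE; apply/eqP.
have := l2norm_sqr v; rewrite v0 expr0n /= => /esym/eqP.
rewrite psumr_eq0 => [/allP/(_ i (mem_index_enum i))|j _]; last exact: sqr_ge0.
rewrite implyTb sqrf_eq0 => /eqP H.
by rewrite (Normc.eq0_normc H).
Qed.

Lemma l2norm_coord n (v : 'cV[C]_n) i : complex.Re `|v i 0| <= l2norm v.
Proof.
rewrite -ler_sqr ?nnegrE ?l2norm_ge0 ?Re_norm_ge0 // l2norm_sqr.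
by rewrite (bigD1 i) //= lerDl sumr_ge0// => j _; exact: sqr_ge0.
Qed.

Lemma l2norm_sum n (I : finType) (F : I -> 'cV[C]_n) :
  l2norm (\sum_i F i) <= \sum_i l2norm (F i).
Proof.
elim/big_ind2 : _ => [|x a y b xa yb|//]; first by rewrite l2norm0.
by apply: le_trans (l2normD _ _) _; exact: lerD.
Qed.

Lemma l2norm_delta n (i : 'I_n) : l2norm (delta_mx i 0 : 'cV[C]_n) = 1.
Proof.
apply/eqP; rewrite -(@eqrXn2 _ 2) ?l2norm_ge0 // l2norm_sqr (bigD1 i) //.
rewrite mxE !eqxx normr1 big1 => [|k ki]; first by rewrite /= expr1n addr0.
by rewrite mxE (negPf ki) normr0 expr0n.
Qed.

(** The supremum defining the norm is over a set bounded by the sum of the norms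
    of the columns; this makes its value meaningful. *)
Lemma opnorm_has_sup n (A : 'M[C]_n) : has_sup
  [set l2norm (A *m v) | v in [set v : 'cV[C]_n | l2norm v <= 1]].
Proof.
split; first by exists (l2norm (A *m 0)); exists 0 => //=; rewrite l2norm0.
exists (\sum_j l2norm (col j A)) => _ [v /= v1 <-].
have -> : A *m v = \sum_j v j 0 *: col j A.
  apply/colP => i; rewrite mxE summxE; apply: eq_bigr => j _.
  by rewrite !mxE mulrC.
apply: le_trans (l2norm_sum _) _; apply: ler_sum => j _.
rewrite l2normZ ler_piMl ?l2norm_ge0 //.
exact: le_trans (l2norm_coord _ _) v1.
Qed.

Lemma opnorm_ge0 n (A : 'M[C]_n) : 0 <= opnorm A.
Proof.
have [_ ub] := opnorm_has_sup A; apply: (@le_trans _ _ (l2norm (A *m 0))).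
  exact: l2norm_ge0.
by apply: ub_le_sup => //; exists 0 => //=; rewrite l2norm0.
Qed.

Lemma l2norm_mulmx n (A : 'M[C]_n) v : l2norm (A *m v) <= opnorm A * l2norm v.
Proof.
have [v0|v0] := eqVneq (l2norm v) 0.
  by rewrite (l2norm_eq0 v0) mulmx0 l2norm0 mulr0.
have vp : 0 < l2norm v by rewrite lt_def v0 l2norm_ge0.
rewrite -ler_pdivrMr //.
have nV : complex.Re `|((l2norm v)^-1)%:C| = (l2norm v)^-1.
  by rewrite ger0_norm // lecR invr_ge0 ltW.
have -> : l2norm (A *m v) / l2norm v = l2norm (A *m (((l2norm v)^-1)%:C *: v)).
  by rewrite -scalemxAr l2normZ nV mulrC.
have [_ ub] := opnorm_has_sup A; apply: ub_le_sup => //.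
by exists (((l2norm v)^-1)%:C *: v) => //=; rewrite l2normZ nV mulVf.
Qed.

Lemma opnorm_le n (A : 'M[C]_n) c : 0 <= c ->
  (forall v, l2norm (A *m v) <= c * l2norm v) -> opnorm A <= c.
Proof.
move=> c0 H; apply: ge_sup => [|_ [v /= v1 <-]].
  by have [] := opnorm_has_sup A.
by apply: le_trans (H v) _; rewrite ler_piMr.
Qed.

#[local] Opaque opnorm.

Lemma opnormD n (A B : 'M[C]_n) : opnorm (A + B) <= opnorm A + opnorm B.
Proof.
apply: opnorm_le => [|v]; first by rewrite addr_ge0 ?opnorm_ge0.
rewrite mulmxDl mulrDl; apply: le_trans (l2normD _ _) _.
by apply: lerD; exact: l2norm_mulmx.
Qed.

Lemma opnormM n (A B : 'M[C]_n) : opnorm (A *m B) <= opnorm A * opnorm B.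
Proof.
apply: opnorm_le => [|v]; first by rewrite mulr_ge0 ?opnorm_ge0.
rewrite -mulmxA -mulrA; apply: le_trans (l2norm_mulmx _ _) _.
by rewrite ler_wpM2l ?opnorm_ge0 ?l2norm_mulmx.
Qed.

Lemma opnormM_le n (A B : 'M[C]_n) a b : opnorm A <= a -> opnorm B <= b ->
  opnorm (A *m B) <= a * b.
Proof.
move=> Aa Bb; apply: le_trans (opnormM A B) _.
by apply: ler_pM => //; exact: opnorm_ge0.
Qed.

Lemma opnorm_scale_le n (c : C) (A : 'M[C]_n) :
  opnorm (c *: A) <= complex.Re `|c| * opnorm A.
Proof.
have c0 := Re_norm_ge0 c.
apply: opnorm_le => [|v]; first by rewrite mulr_ge0 ?opnorm_ge0.
by rewrite -scalemxAl l2normZ -mulrA ler_wpM2l ?l2norm_mulmx.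
Qed.

Lemma opnorm_scaleR_le n (c : R) (A : 'M[C]_n) :
  opnorm (c%:C *: A) <= `|c| * opnorm A.
Proof.
apply: le_trans (opnorm_scale_le _ _) _; rewrite ler_wpM2r ?opnorm_ge0 //.
by rewrite normc_def /= expr0n addr0 sqrtr_sqr.
Qed.

Lemma opnormN n (A : 'M[C]_n) : opnorm (- A) = opnorm A.
Proof.
have H (B : 'M[C]_n) : opnorm (- B) <= opnorm B.
  rewrite -scaleN1r; apply: le_trans (opnorm_scale_le _ _) _.
  by rewrite normrN1 mul1r.
apply: le_anti; apply/andP; split; first exact: H.
by have := H (- A); rewrite opprK.
Qed.

Lemma opnormB n (A B : 'M[C]_n) : opnorm (A - B) <= opnorm A + opnorm B.
Proof. by rewrite -(opnormN B) opnormD. Qed.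

Lemma opnorm_distC n (A B : 'M[C]_n) : opnorm (A - B) = opnorm (B - A).
Proof. by rewrite -opnormN opprB. Qed.

Lemma opnorm0 n : opnorm (0 : 'M[C]_n) = 0.
Proof.
apply: le_anti; rewrite opnorm_ge0 andbT; apply: opnorm_le => // v.
by rewrite mul0mx l2norm0 mul0r.
Qed.

Lemma opnorm_sum n (I : finType) (F : I -> 'M[C]_n) :
  opnorm (\sum_i F i) <= \sum_i opnorm (F i).
Proof.
elim/big_ind2 : _ => [|x a y b xa yb|//]; first by rewrite opnorm0.
by apply: le_trans (opnormD _ _) _; exact: lerD.
Qed.

Lemma adjmxM m n p (A : 'M[C]_(m, n)) (B : 'M[C]_(n, p)) :
  (A *m B)^t* = B^t* *m A^t*.
Proof. by rewrite trmx_mul map_mxM. Qed.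

Lemma l2norm_isometry n (U : 'M[C]_n) v : U^t* *m U = 1%:M ->
  l2norm (U *m v) = l2norm v.
Proof.
move=> U1; have : cdot (U *m v) (U *m v) = cdot v v.
  by rewrite /cdot adjmxM -mulmxA [_ *m (U *m _)]mulmxA U1 mul1mx.
rewrite !cdot_l2norm => -[] /eqP.
by rewrite eqrXn2 ?l2norm_ge0 // => /eqP.
Qed.

(** Divide |A^* v|^2 = <v, A A^* v> <= |A| |v| |A^* v| by |A^* v|. *)
Lemma opnorm_adj n (A : 'M[C]_n) : opnorm (A^t* ) = opnorm A.
Proof.
have H (B : 'M[C]_n) : opnorm (B^t* ) <= opnorm B.
  apply: opnorm_le => [|v]; first exact: opnorm_ge0.
  have [->|w0] := eqVneq (l2norm (B^t* *m v)) 0.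
    by rewrite mulr_ge0 ?opnorm_ge0 ?l2norm_ge0.
  have wp : 0 < l2norm (B^t* *m v) by rewrite lt_def w0 l2norm_ge0.
  rewrite -(ler_pM2r wp) -expr2.
  have -> : l2norm (B^t* *m v) ^+ 2 = complex.Re (cdot v (B *m (B^t* *m v))).
    suff -> : cdot v (B *m (B^t* *m v)) = cdot (B^t* *m v) (B^t* *m v).
      by rewrite cdot_l2norm.
    by rewrite /cdot adjmxM trmxCK !mulmxA.
  apply: le_trans (Re_cdot_le _ _) _; rewrite mulrAC [X in _ <= X]mulrC.
  by rewrite ler_wpM2l ?l2norm_ge0 // l2norm_mulmx.
apply: le_anti; apply/andP; split; first exact: H.
by have := H (A^t* ); rewrite trmxCK.
Qed.

Lemma opnorm_unitary n (U : 'M[C]_n) : U \is unitarymx -> opnorm U <= 1.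
Proof.
move=> Uu; apply: opnorm_le => // v; rewrite mul1r l2norm_isometry //.
by rewrite -[X in _ *m X]trmxCK; apply/unitarymxP; rewrite trmxC_unitary.
Qed.

Lemma opnorm1 n : opnorm (1%:M : 'M[C]_n) <= 1.
Proof. by apply: opnorm_le => // v; rewrite mul1mx mul1r. Qed.

(** The nontrivial half of the C*-identity: |A v|^2 = <v, A^* A v>. *)
Lemma opnorm_sq_le n (A : 'M[C]_n) : opnorm A ^+ 2 <= opnorm (A^t* *m A).
Proof.
move: (opnorm (A^t* *m A)) (opnorm_ge0 (A^t* *m A)) (l2norm_mulmx (A^t* *m A)).
move=> c c0 H.
apply: (le_sqrt_sqr (opnorm_ge0 _) c0); apply: opnorm_le => [|v]; first exact: sqrtr_ge0.
apply: (le_sqrtM (l2norm_ge0 _) (l2norm_ge0 _) c0).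
have -> : l2norm (A *m v) ^+ 2 = complex.Re (cdot v (A^t* *m A *m v)).
  suff -> : cdot v (A^t* *m A *m v) = cdot (A *m v) (A *m v).
    by rewrite cdot_l2norm.
  by rewrite /cdot adjmxM !mulmxA.
apply: le_trans (Re_cdot_le _ _) _.
by rewrite expr2 mulrCA ler_wpM2l ?l2norm_ge0 // H.
Qed.

Lemma l2norm_col_mx n1 n2 (u : 'cV[C]_n1) (v : 'cV[C]_n2) :
  l2norm (col_mx u v) ^+ 2 = l2norm u ^+ 2 + l2norm v ^+ 2.
Proof.
rewrite !l2norm_sqr big_split_ord /=; congr (_ + _); apply: eq_bigr => i _.
  by rewrite col_mxEu.
by rewrite col_mxEd.
Qed.

Lemma l2norm_col_mx_ge n1 n2 (u : 'cV[C]_n1) (v : 'cV[C]_n2) :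
  l2norm u <= l2norm (col_mx u v) /\ l2norm v <= l2norm (col_mx u v).
Proof.
have sq (a b : R) : 0 <= a -> 0 <= b -> a ^+ 2 <= b ^+ 2 -> a <= b.
  by move=> a0 b0; rewrite ler_sqr.
split; apply: (sq _ _ (l2norm_ge0 _) (l2norm_ge0 _)); rewrite l2norm_col_mx.
  by rewrite lerDl sqr_ge0.
by rewrite lerDr sqr_ge0.
Qed.

Lemma l2norm_col_mx_le n1 n2 (u : 'cV[C]_n1) (v : 'cV[C]_n2) :
  l2norm (col_mx u v) <= l2norm u + l2norm v.
Proof.
rewrite -ler_sqr ?nnegrE ?addr_ge0 ?l2norm_ge0 // l2norm_col_mx.
have := l2norm_ge0 u; have := l2norm_ge0 v; nra.
Qed.

Lemma opnorm_block n1 (A B D E : 'M[C]_n1) :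
  opnorm (block_mx A B D E) <= opnorm A + opnorm B + (opnorm D + opnorm E).
Proof.
apply: opnorm_le => [|v]; first by rewrite !addr_ge0 ?opnorm_ge0.
rewrite -[v]vsubmxK mul_block_col.
set u := usubmx v; set w := dsubmx v.
have [uv wv] := l2norm_col_mx_ge u w.
have H (M : 'M[C]_n1) (x : 'cV[C]_n1) : l2norm x <= l2norm (col_mx u w) ->
    l2norm (M *m x) <= opnorm M * l2norm (col_mx u w).
  move=> xle; apply: le_trans (l2norm_mulmx _ _) _.
  by rewrite ler_wpM2l ?opnorm_ge0.
have /le_trans := l2norm_col_mx_le (A *m u + B *m w) (D *m u + E *m w).
apply.
have := le_trans (l2normD (A *m u) (B *m w)) (lerD (H A _ uv) (H B _ wv)).
have := le_trans (l2normD (D *m u) (E *m w)) (lerD (H D _ uv) (H E _ wv)).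
move: (l2norm (A *m u + B *m w)) (l2norm (D *m u + E *m w)) => x y.
move: (l2norm (col_mx u w)) (opnorm A) (opnorm B) (opnorm D) (opnorm E).
by move=> l a b d e yle xle; rewrite !mulrDl; exact: lerD.
Qed.

Lemma opnorm_diag_ge n (d : 'rV[C]_n) i :
  complex.Re `|d 0 i| <= opnorm (diag_mx d).
Proof.
have := l2norm_mulmx (diag_mx d) (delta_mx i 0).
rewrite l2norm_delta mulr1; apply: le_trans.
rewrite (_ : diag_mx d *m delta_mx i 0 = d 0 i *: delta_mx i 0).
  by rewrite l2normZ l2norm_delta mulr1.
apply/colP => j; rewrite mul_diag_mx !mxE.
by case: eqVneq => [->//|]; rewrite !mulr0.
Qed.

End OperatorNorm.

(** * Functional calculus of Hermitian matrices *)

Section FunctionalCalculus.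
Variable R : realType.
Local Notation C := R[i].
#[local] Opaque l2norm opnorm.

Definition rdiag n (d : 'I_n -> R) : 'M[C]_n := diag_mx (\row_i (d i)%:C).

Definition spv n (A : 'M[C]_n) (i : 'I_n) : R := complex.Re (spectral_diag A 0 i).

Definition spectrum n (A : 'M[C]_n) (t : R) : Prop := exists i, t = spv A i.

Lemma rdiagE n (d : 'I_n -> R) i j : rdiag d i j = (d i)%:C *+ (i == j).
Proof. by rewrite !mxE. Qed.

Lemma rdiag_mull n p (d : 'I_n -> R) (M : 'M[C]_(n, p)) i j :
  (rdiag d *m M) i j = (d i)%:C * M i j.
Proof. by rewrite mul_diag_mx !mxE. Qed.

Lemma rdiag_mulr n p (d : 'I_n -> R) (M : 'M[C]_(p, n)) i j :
  (M *m rdiag d) i j = M i j * (d j)%:C.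
Proof. by rewrite mul_mx_diag !mxE. Qed.

Lemma rdiag_adj n (d : 'I_n -> R) : (rdiag d)^t* = rdiag d.
Proof.
apply/matrixP => i j; rewrite !mxE eq_sym.
case: eqVneq => [->|_]; last by rewrite !mulr0n rmorph0.
by rewrite !mulr1n; exact: conjc_real.
Qed.

Lemma unitarymxK n (V : 'M[C]_n) : V \is unitarymx -> V^t* *m V = 1%:M.
Proof.
by move=> Vu; rewrite -[X in _ *m X]trmxCK; apply/unitarymxP; rewrite trmxC_unitary.
Qed.

Lemma fun_calcE n h (A : 'M[C]_n) :
  fun_calc h A = (spectralmx A)^t* *m rdiag (h \o spv A) *m spectralmx A.
Proof.
have dE : map_mx (fun z => (h (complex.Re z))%:C) (spectral_diag A) =
    \row_i (h (spv A i))%:C by apply/rowP => i; rewrite !mxE.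
by rewrite /fun_calc dE (invmx_unitary (spectral_unitarymx A)).
Qed.

#[local] Opaque fun_calc.

Lemma spectral_dec n (A : 'M[C]_n) : A^t* = A ->
  A = (spectralmx A)^t* *m rdiag (spv A) *m spectralmx A.
Proof.
move=> hA; have Ah : A \is hermsymmx.
  by apply/is_hermitianmxP; rewrite expr0 scale1r hA.
have /orthomx_spectralP := hermitian_normalmx Ah.
have /mxOverP rA := hermitian_spectral_diag_real Ah.
have dE : spectral_diag A = \row_i (spv A i)%:C.
  by apply/rowP => i; rewrite mxE /spv RRe_real.
by rewrite {1}dE (invmx_unitary (spectral_unitarymx A)).
Qed.

(** In eigenbases the hypothesis reads (d_i - e_j) S_ij = 0, which forces
    (F d_i - F e_j) S_ij = 0.  This one observation gives the independence of the
    diagonalization, the composition rule and the commutation with the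
    commutant. *)
Lemma rdiag_intertwine n (V V' W W' T : 'M[C]_n) (d e : 'I_n -> R) (F : R -> R) :
  V *m V' = 1%:M -> V' *m V = 1%:M -> W *m W' = 1%:M -> W' *m W = 1%:M ->
  V' *m rdiag d *m V *m T = T *m (W' *m rdiag e *m W) ->
  V' *m rdiag (F \o d) *m V *m T = T *m (W' *m rdiag (F \o e) *m W).
Proof.
move=> V1 V2 W1 W2 E; pose S := V *m T *m W'.
have VS : T = V' *m S *m W by rewrite /S !mulmxA V2 mul1mx -mulmxA W2 mulmx1.
have ES : rdiag d *m S = S *m rdiag e.
  have := congr1 (fun X => V *m X *m W') E.
  by rewrite /S !mulmxA V1 mul1mx => ->; rewrite -[LHS]mulmxA W1 mulmx1.
have EF : rdiag (F \o d) *m S = S *m rdiag (F \o e).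
  apply/matrixP => i j; have /matrixP/(_ i j) := ES.
  rewrite !rdiag_mull !rdiag_mulr /= [S i j * _]mulrC [S i j * _]mulrC.
  have [->|S0] := eqVneq (S i j) 0; first by rewrite !mulr0.
  by move/(mulIf S0)/complexI => ->.
clearbody S; rewrite VS !mulmxA -[_ *m V *m V']mulmxA V1 mulmx1.
rewrite -[_ *m W *m W']mulmxA W1 mulmx1.
by rewrite -[V' *m _ *m S]mulmxA EF !mulmxA.
Qed.

Lemma fun_calc_intertwine n (A B T : 'M[C]_n) F : A^t* = A -> B^t* = B ->
  A *m T = T *m B -> fun_calc F A *m T = T *m fun_calc F B.
Proof.
move=> hA hB; rewrite {1}(spectral_dec hA) {1}(spectral_dec hB) !fun_calcE.
have Au := spectral_unitarymx A; have Bu := spectral_unitarymx B.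
exact: (rdiag_intertwine _ (unitarymxP Au) (unitarymxK Au) (unitarymxP Bu)
  (unitarymxK Bu)).
Qed.

Lemma fun_calc_unique n (V : 'M[C]_n) d F : V \is unitarymx ->
  fun_calc F (V^t* *m rdiag d *m V) = V^t* *m rdiag (F \o d) *m V.
Proof.
move=> Vu; set A := V^t* *m _ *m V.
have hA : A^t* = A by rewrite /A !adjmxM trmxCK rdiag_adj mulmxA.
rewrite fun_calcE -[LHS]mulmx1 -[RHS]mul1mx.
have Au := spectral_unitarymx A.
apply: (rdiag_intertwine _ (unitarymxP Au) (unitarymxK Au) (unitarymxP Vu)
  (unitarymxK Vu)).
by rewrite mulmx1 mul1mx -(spectral_dec hA).
Qed.

Lemma fun_calc_adj n (A : 'M[C]_n) F : (fun_calc F A)^t* = fun_calc F A.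
Proof. by rewrite fun_calcE !adjmxM trmxCK rdiag_adj mulmxA. Qed.

Lemma fun_calc_comp n (A : 'M[C]_n) F G :
  fun_calc G (fun_calc F A) = fun_calc (G \o F) A.
Proof.
by rewrite [fun_calc F A]fun_calcE (fun_calc_unique _ _ (spectral_unitarymx A))
  [RHS]fun_calcE.
Qed.

Lemma fun_calc_ext n (A : 'M[C]_n) F G :
  (forall t, spectrum A t -> F t = G t) -> fun_calc F A = fun_calc G A.
Proof.
move=> FG; have E : F \o spv A = G \o spv A.
  by apply: funext => i /=; apply: FG; exists i.
by rewrite !fun_calcE E.
Qed.

Lemma fun_calc_id n (A : 'M[C]_n) : A^t* = A -> fun_calc id A = A.
Proof. by move=> hA; rewrite [RHS](spectral_dec hA) fun_calcE. Qed.

Lemma fun_calcM n (A : 'M[C]_n) F G :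
  fun_calc (fun t => F t * G t) A = fun_calc F A *m fun_calc G A.
Proof.
rewrite !fun_calcE; move: (spectralmx A) ((spectralmx A)^t* )
  (unitarymxP (spectral_unitarymx A)) => V V' V1.
have -> : rdiag ((fun t => F t * G t) \o spv A) =
    rdiag (F \o spv A) *m rdiag (G \o spv A).
  apply/matrixP => i j.
  by rewrite rdiag_mull !rdiagE /= rmorphM mulrnAr.
by rewrite !mulmxA -[_ *m V *m V']mulmxA V1 mulmx1.
Qed.

Lemma fun_calc_lin n (A : 'M[C]_n) (c : R) F G :
  fun_calc (fun t => c * F t + G t) A = c%:C *: fun_calc F A + fun_calc G A.
Proof.
rewrite !fun_calcE scalemxAl scalemxAr -mulmxDl -mulmxDr.
congr (_ *m _ *m _); apply/matrixP => i j; rewrite rdiagE 2!mxE !rdiagE.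
by rewrite /= rmorphD rmorphM mulrnDl mulrnAr.
Qed.

Lemma fun_calc_cst n (A : 'M[C]_n) (c : R) : fun_calc (fun=> c) A = c%:C%:M.
Proof.
rewrite fun_calcE (_ : rdiag _ = c%:C%:M).
  rewrite mul_mx_scalar -scalemxAl unitarymxK ?spectral_unitarymx //.
  by rewrite scalemx1.
by apply/matrixP => i j; rewrite !mxE.
Qed.

Lemma l2norm_le_coord n (u v : 'cV[C]_n) :
  (forall i, complex.Re `|u i 0| <= complex.Re `|v i 0|) -> l2norm u <= l2norm v.
Proof.
move=> uv; have sq (a b : R) : 0 <= a -> 0 <= b -> a ^+ 2 <= b ^+ 2 -> a <= b.
  by move=> a0 b0; rewrite ler_sqr.
apply: (sq _ _ (l2norm_ge0 u) (l2norm_ge0 v)); rewrite !l2norm_sqr.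
by apply: ler_sum => i _; rewrite ler_pXn2r ?nnegrE ?Re_norm_ge0.
Qed.

Lemma normc_real (x : R) : `|x%:C| = `|x|%:C.
Proof. by rewrite normc_def /= expr0n addr0 sqrtr_sqr. Qed.

Lemma l2norm_rdiag_le n (d e : 'I_n -> R) (w : 'cV[C]_n) :
  (forall i, `|d i| <= `|e i|) -> l2norm (rdiag d *m w) <= l2norm (rdiag e *m w).
Proof.
move=> de; apply: l2norm_le_coord => i; rewrite !rdiag_mull !normrM.
rewrite !normc_real (normCE (w i 0)) -!rmorphM /=.
by rewrite ler_wpM2r ?Re_norm_ge0.
Qed.

Lemma l2norm_fun_calc n (A : 'M[C]_n) F (x : 'cV[C]_n) :
  l2norm (fun_calc F A *m x) =
  l2norm (rdiag (F \o spv A) *m (spectralmx A *m x)).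
Proof.
rewrite fun_calcE -!mulmxA; apply: l2norm_isometry; rewrite trmxCK.
exact/unitarymxP/spectral_unitarymx.
Qed.

Lemma le_congr (a b c d : R) : a = c -> b = d -> c <= d -> a <= b.
Proof. by move=> -> ->. Qed.

(** In an eigenbasis of A each coordinate of F(A) M v is dominated by the same
    coordinate of G(A) M v.  This compares the defect of the cutoff with
    a polynomial, whose values are known by hypothesis. *)
Lemma fun_calc_dominate n (A M : 'M[C]_n) F G :
  (forall t, spectrum A t -> `|F t| <= `|G t|) ->
  opnorm (fun_calc F A *m M) <= opnorm (fun_calc G A *m M).
Proof.
move=> FG; apply: opnorm_le => [|v]; first exact: opnorm_ge0.
have /(le_trans _) := l2norm_mulmx (fun_calc G A *m M) v; apply.
have E H : l2norm (fun_calc H A *m M *m v) =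
    l2norm (rdiag (H \o spv A) *m (spectralmx A *m (M *m v))).
  by rewrite -mulmxA; exact: l2norm_fun_calc.
apply: le_congr (E F) (E G) _; apply: l2norm_rdiag_le => i /=.
by apply: FG; exists i.
Qed.

Lemma opnorm_scalar_le n (c : R) : opnorm (c%:C%:M : 'M[C]_n) <= `|c|.
Proof.
rewrite -scalemx1; apply: le_trans (opnorm_scaleR_le _ _) _.
by rewrite ler_piMr // opnorm1.
Qed.

(** An eigenvalue is controlled through any function of the matrix; with
    g(t) = t - t^2 this locates the spectrum of an almost projection. *)
Lemma spectrum_le n (A : 'M[C]_n) t g : spectrum A t ->
  `|g t| <= opnorm (fun_calc g A).
Proof.
move=> [i ->].
have -> : `|g (spv A i)| = complex.Re `|(\row_i (g (spv A i))%:C : 'rV[C]_n) 0 i|.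
  by rewrite mxE normc_def /= expr0n addr0 sqrtr_sqr.
apply: le_trans (opnorm_diag_ge _ _) _; set V := spectralmx A.
have Vu : V \is unitarymx by exact: spectral_unitarymx.
have -> : diag_mx (\row_i (g (spv A i))%:C) = V *m fun_calc g A *m V^t*.
  rewrite fun_calcE -/V; move: (V) (V^t* ) (unitarymxP Vu) => W W' W1.
  by rewrite !mulmxA W1 mul1mx -mulmxA W1 mulmx1.
have V1 := opnorm_unitary Vu.
have V2 : opnorm (V^t* ) <= 1 by rewrite opnorm_adj.
have := opnormM_le (opnormM_le V1 (lexx (opnorm (fun_calc g A)))) V2.
by rewrite mul1r mulr1.
Qed.

End FunctionalCalculus.

(** * Algebras with a norm and a functional calculus *)

(** The estimates below use these properties of Hermitian matrices only.  Their
    constants have to be the same for all matrix sizes, which is expressed by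
    quantifying over all such algebras after the constants.  [emb] embeds the
    real scalars and [sp a] is the spectrum of a selfadjoint a. *)
Record opAlgebra (R : realType) := OpAlgebra {
  opalg :> pzRingType;
  nrm : opalg -> R;
  adj : opalg -> opalg;
  emb : R -> opalg;
  fc : (R -> R) -> opalg -> opalg;
  sp : opalg -> R -> Prop;
  nrm_ge0 : forall x, 0 <= nrm x;
  nrmD : forall x y, nrm (x + y) <= nrm x + nrm y;
  nrmN : forall x, nrm (- x) = nrm x;
  nrmM : forall x y, nrm (x * y) <= nrm x * nrm y;
  nrm_adj : forall x, nrm (adj x) = nrm x;
  nrm_sq : forall x, nrm x ^+ 2 <= nrm (adj x * x);
  adjM : forall x y, adj (x * y) = adj y * adj x;
  adjB : forall x y, adj (x - y) = adj x - adj y;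
  emb1 : emb 1 = 1;
  nrm_emb : forall c, nrm (emb c) <= `|c|;
  fc_id : forall a, adj a = a -> fc id a = a;
  fc_cst : forall c a, fc (fun=> c) a = emb c;
  fcD : forall F G a, fc (fun t => F t + G t) a = fc F a + fc G a;
  fcM : forall F G a, fc (fun t => F t * G t) a = fc F a * fc G a;
  fc_adj : forall F a, adj (fc F a) = fc F a;
  fc_comp : forall F G a, fc G (fc F a) = fc (G \o F) a;
  fc_intertwine : forall F a b x, adj a = a -> adj b = b ->
    a * x = x * b -> fc F a * x = x * fc F b;
  fc_ext_sp : forall F G a, (forall t, sp a t -> F t = G t) -> fc F a = fc G a;
  fc_dominate : forall F G a x, (forall t, sp a t -> `|F t| <= `|G t|) ->
    nrm (fc F a * x) <= nrm (fc G a * x);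
  sp_le : forall F a t, sp a t -> `|F t| <= nrm (fc F a)
}.

Section OpAlgebraTheory.
Variables (R : realType) (A : opAlgebra R).
Implicit Types (a b x y : A) (F G : R -> R).

Lemma nrm0 : nrm (0 : A) = 0.
Proof.
apply: le_anti; rewrite nrm_ge0 andbT.
have := nrm_emb A 0; rewrite normr0 => /(ler_wpM2l (nrm_ge0 (0 : A))).
by rewrite mulr0; apply: le_trans; rewrite -{1}(mul0r (emb A 0)) nrmM.
Qed.

Lemma nrm1 : nrm (1 : A) <= 1.
Proof. by rewrite -emb1; apply: le_trans (nrm_emb A 1) _; rewrite normr1. Qed.

Lemma nrmB x y : nrm (x - y) <= nrm x + nrm y.
Proof. by rewrite -(nrmN y) nrmD. Qed.

Lemma nrmM_le x y c d : nrm x <= c -> nrm y <= d -> nrm (x * y) <= c * d.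
Proof.
by move=> xc yd; apply: le_trans (nrmM x y) _; apply: ler_pM; rewrite ?nrm_ge0.
Qed.

Lemma nrm_sa_sq x : adj x = x -> nrm x ^+ 2 <= nrm (x * x).
Proof. by move=> hx; have := nrm_sq x; rewrite hx. Qed.

Lemma fc_ext F G a : F =1 G -> fc F a = fc G a.
Proof. by move=> /funext ->. Qed.

Lemma fcB F G a : fc (fun t => F t - G t) a = fc F a - fc G a.
Proof.
apply/eqP; rewrite -subr_eq opprK -fcD; apply/eqP/fc_ext => t.
by rewrite subrK.
Qed.

Lemma sp_nrm a t : adj a = a -> sp a t -> `|t| <= nrm a.
Proof. by move=> ha /(sp_le id); rewrite fc_id. Qed.

Lemma nrm_fc F a c : 0 <= c -> (forall t, sp a t -> `|F t| <= c) ->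
  nrm (fc F a) <= c.
Proof.
move=> c0 Fc; rewrite -[fc F a]mulr1.
apply: le_trans (_ : nrm (fc (fun=> c) a * 1) <= _).
  by apply: fc_dominate => t /Fc; rewrite (ger0_norm c0).
by rewrite mulr1 fc_cst; apply: le_trans (nrm_emb A c) _; rewrite ger0_norm.
Qed.

Lemma nrm_fc_bound F a K c : adj a = a -> nrm a <= K -> 0 <= c ->
  (forall t, `|t| <= K -> `|F t| <= c) -> nrm (fc F a) <= c.
Proof.
move=> ha aK c0 Fc; apply: nrm_fc => // t /(sp_nrm ha) ta.
by apply: Fc; exact: le_trans aK.
Qed.

End OpAlgebraTheory.

(** * Stable functions *)

Section StableFunctions.
Variable R : realType.

(** The multiplier x is what makes this stronger than uniform continuity: a and
    b may be far apart, provided x, which commutes with a, kills the difference.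
    The modulus delta is chosen before the algebra. *)
Definition stable (K : R) (F : R -> R) : Prop :=
  (exists M, forall t, `|t| <= K -> `|F t| <= M) /\
  forall eta, 0 < eta -> exists2 delta, 0 < delta &
    forall (A : opAlgebra R) (a b x : A), adj a = a -> adj b = b ->
      nrm a <= K -> nrm b <= K -> nrm x <= 1 ->
      a * x = x * a -> nrm (x * (a - b)) <= delta ->
      nrm (x * (fc F a - fc F b)) <= eta.

Variable K : R.

Lemma stable_cst c : stable K (fun=> c).
Proof.
split; first by exists `|c|.
move=> eta eta0; exists 1 => // A a b x *.
by rewrite !fc_cst subrr mulr0 nrm0 ltW.
Qed.

Lemma stable_id : stable K id.
Proof.
split; first by exists K.
by move=> eta eta0; exists eta => // A a b x ha hb *; rewrite !fc_id.
Qed.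

Lemma stableD F G : stable K F -> stable K G -> stable K (fun t => F t + G t).
Proof.
move=> [[M FM] Fs] [[N GN] Gs]; split.
  exists (M + N) => t tK; apply: le_trans (ler_normD _ _) _.
  by apply: lerD; [exact: FM|exact: GN].
move=> eta eta0; have e2 : 0 < eta / 2 by rewrite divr_gt0.
have [d1 d10 H1] := Fs _ e2; have [d2 d20 H2] := Gs _ e2.
exists (Num.min d1 d2); first by rewrite lt_min d10.
move=> A a b x ha hb aK bK x1 ax; rewrite le_min => /andP[xd1 xd2].
rewrite !fcD opprD addrACA mulrDr; apply: le_trans (nrmD _ _) _.
rewrite [leRHS](splitr eta).
by apply: lerD; [exact: H1 xd1|exact: H2 xd2].
Qed.

(** x (F a G a - F b G b) = F a (x (G a - G b)) + (x (F a - F b)) G b, where x has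
    been moved across F a because it commutes with a. *)
Lemma stableM F G : stable K F -> stable K G -> stable K (fun t => F t * G t).
Proof.
move=> [[M FM] Fs] [[N GN] Gs]; split.
  exists (M * N) => t tK; rewrite normrM.
  by apply: ler_pM => //; [exact: FM|exact: GN].
move=> eta eta0; set c := `|M| + `|N| + 1.
have M0 := normr_ge0 M; have N0 := normr_ge0 N.
have c0 : 0 < c by rewrite ltr_wpDl ?addr_ge0.
have e2 : 0 < eta / 2 / c by rewrite !divr_gt0.
have [d1 d10 H1] := Fs _ e2; have [d2 d20 H2] := Gs _ e2.
exists (Num.min d1 d2); first by rewrite lt_min d10.
move=> A a b x ha hb aK bK x1 ax; rewrite le_min => /andP[xd1 xd2].
have Fa : nrm (fc F a) <= c.
  apply: (nrm_fc_bound ha aK) => [|t tK]; first exact: ltW.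
  by apply: le_trans (FM t tK) _; apply: le_trans (ler_norm M) _; rewrite /c; lra.
have Gb : nrm (fc G b) <= c.
  apply: (nrm_fc_bound hb bK) => [|t tK]; first exact: ltW.
  by apply: le_trans (GN t tK) _; apply: le_trans (ler_norm N) _; rewrite /c; lra.
have xF := H1 _ _ _ _ ha hb aK bK x1 ax xd1.
have xG := H2 _ _ _ _ ha hb aK bK x1 ax xd2.
have Fx := fc_intertwine F ha ha ax.
rewrite !fcM.
have -> : x * (fc F a * fc G a - fc F b * fc G b) =
    fc F a * (x * (fc G a - fc G b)) + x * (fc F a - fc F b) * fc G b.
  by rewrite !mulrBr !mulrBl !mulrA Fx addrA subrK.
apply: le_trans (nrmD _ _) _; rewrite [leRHS](splitr eta); apply: lerD.
  by apply: le_trans (nrmM_le Fa xG) _; rewrite mulrC divfK ?gt_eqF.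
by apply: le_trans (nrmM_le xF Gb) _; rewrite divfK ?gt_eqF.
Qed.

Lemma stable_lim F :
  (forall eta, 0 < eta -> exists2 G, stable K G &
     forall t, `|t| <= K -> `|F t - G t| <= eta) -> stable K F.
Proof.
move=> FG; split.
  have [G [[M GM] _] FG1] := FG 1 ltr01; exists (1 + M) => t tK.
  rewrite -(subrK (G t) (F t)); apply: le_trans (ler_normD _ _) _.
  by apply: lerD; [exact: FG1|exact: GM].
move=> eta eta0; have e3 : 0 < eta / 3 by rewrite divr_gt0.
have [G [_ Gs] FG1] := FG _ e3; have [d d0 H] := Gs _ e3.
exists d => // A a b x ha hb aK bK x1 ax xd.
have xG := H _ _ _ _ ha hb aK bK x1 ax xd.
have Fa : nrm (fc F a - fc G a) <= eta / 3.
  by rewrite -fcB; apply: (nrm_fc_bound ha aK) => //; exact: ltW.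
have Fb : nrm (fc F b - fc G b) <= eta / 3.
  by rewrite -fcB; apply: (nrm_fc_bound hb bK) => //; exact: ltW.
have -> : x * (fc F a - fc F b) = x * (fc G a - fc G b) +
   (x * (fc F a - fc G a) - x * (fc F b - fc G b)).
  rewrite -mulrBr -mulrDr; congr (x * _).
  by rewrite opprB [fc F a - _ + _]addrC addrA subrKA addrC subrKA.
have := nrmM_le x1 Fa; have := nrmM_le x1 Fb; rewrite !mul1r => xb xa.
apply: le_trans (nrmD _ _) _; apply: le_trans (lerD xG (nrmB _ _)) _.
by move: (lerD xa xb); lra.
Qed.

Lemma stable_ext F G : (forall t, `|t| <= K -> F t = G t) -> stable K F ->
  stable K G.
Proof.
move=> FG Fs; apply: stable_lim => eta eta0; exists F => // t /FG ->.
by rewrite subrr normr0 ltW.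
Qed.

Lemma stableZ c F : stable K F -> stable K (fun t => c * F t).
Proof. by apply: stableM; exact: stable_cst. Qed.

Lemma stableB F G : stable K F -> stable K G -> stable K (fun t => F t - G t).
Proof.
move=> Fs Gs; apply: (@stable_ext (fun t => F t + (-1) * G t)).
  by move=> t _; rewrite mulN1r.
by apply: stableD => //; exact: stableZ.
Qed.

(** Polynomials in F that increase to the square root of F. *)
Fixpoint sqrt_iter (F : R -> R) (n : nat) (t : R) : R :=
  if n is n'.+1 then
    2^-1 * (F t - sqrt_iter F n' t * sqrt_iter F n' t) + sqrt_iter F n' t
  else 0.

Lemma stable_sqrt_iter F n : stable K F -> stable K (sqrt_iter F n).
Proof.
move=> Fs; elim: n => [|n IH] /=; first exact: stable_cst.
by apply/stableD/IH/stableZ/stableB/stableM.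
Qed.

(** The error e_n = sqrt F - s_n satisfies
    e_(n+1) = e_n (1 - (sqrt F + s_n)/2) <= e_n (1 - sqrt F / 2), and
    (1 - x/2)(2 + (n+1) x) <= 2 + n x; hence e_n <= 2/n, uniformly in F. *)
Lemma sqrt_iter_err F n t : 0 <= F t <= 1 ->
  [/\ 0 <= Num.sqrt (F t) - sqrt_iter F n t,
   (Num.sqrt (F t) - sqrt_iter F n t) * (2 + n%:R * Num.sqrt (F t))
     <= 2 * Num.sqrt (F t) & 0 <= sqrt_iter F n t].
Proof.
move=> /andP[F0 F1].
have x0 : 0 <= Num.sqrt (F t) by exact: sqrtr_ge0.
have x1 : Num.sqrt (F t) <= 1 by rewrite -sqrtr1 ler_sqrt.
have xx : F t = Num.sqrt (F t) ^+ 2 by rewrite sqr_sqrtr.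
elim: n => [|n [e0 e2 s0]] /=.
  by rewrite subr0 mul0r addr0 mulrC; split.
have E : 2^-1 * (F t - sqrt_iter F n t * sqrt_iter F n t) + sqrt_iter F n t =
    Num.sqrt (F t) - (Num.sqrt (F t) - sqrt_iter F n t) *
      (1 - (Num.sqrt (F t) + sqrt_iter F n t) / 2).
  by rewrite {1}xx; field.
rewrite E; move: (Num.sqrt (F t)) (sqrt_iter F n t) x0 x1 e0 e2 s0 => x s.
move=> {E xx} x0 x1 e0 e2 s0.
have n0 : 0 <= n%:R :> R by exact: ler0n.
have -> : n.+1%:R = n%:R + 1 :> R by rewrite natr1.
move: (n%:R) n0 e2 => k k0 e2.
have h0 : 0 <= 1 - (x + s) / 2 by lra.
have h1 : 1 - (x + s) / 2 <= 1 - x / 2 by lra.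
rewrite subKr; split; first exact: mulr_ge0.
  apply: (@le_trans _ _ ((x - s) * (1 - x / 2) * (2 + (k + 1) * x))).
    apply: ler_wpM2r; last exact: ler_wpM2l.
    by rewrite addr_ge0 // mulr_ge0 // addr_ge0.
  apply: le_trans e2; rewrite -mulrA; apply: ler_wpM2l => //.
  have k1 : 0 <= k * (x * x) by rewrite !mulr_ge0.
  have k2 : 0 <= x * x by rewrite mulr_ge0.
  nra.
have : (x - s) * (1 - (x + s) / 2) <= (x - s) * 1 by rewrite ler_wpM2l //; lra.
lra.
Qed.

Lemma stable_sqrt F : stable K F ->
  (forall t, `|t| <= K -> 0 <= F t <= 1) -> stable K (fun t => Num.sqrt (F t)).
Proof.
move=> Fs F01; apply: stable_lim => eta eta0.
have := archi_boundP (divr_ge0 (ler0n R 2) (ltW eta0)).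
move: (Num.bound _) => n nP.
exists (sqrt_iter F n); first exact: stable_sqrt_iter.
move=> t /F01 /(sqrt_iter_err n) [e0 e2 s0]; rewrite ger0_norm //.
move: (sqrtr_ge0 (F t)) e0 e2 s0; move: (Num.sqrt (F t)) (sqrt_iter F n t).
move=> x s; rewrite le_eqVlt => /orP[/eqP <-|x0] e0 e2 s0.
  by rewrite sub0r; apply: le_trans (ltW eta0); rewrite oppr_le0.
have ne : 2 <= n%:R * eta by rewrite -ler_pdivrMr // ltW.
have n0 : 0 < n%:R :> R by apply: le_lt_trans nP; rewrite divr_ge0 // ltW.
have h : (x - s) * n%:R <= 2.
  rewrite -(ler_pM2r x0); apply: le_trans e2; rewrite -mulrA ler_wpM2l //.
  by rewrite lerDr.
by rewrite -(ler_pM2r n0) (le_trans h) // mulrC.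
Qed.

(** |F| is the square root of F^2, after scaling to [0, 1]. *)
Lemma stable_abs F : stable K F -> stable K (fun t => `|F t|).
Proof.
move=> Fs; have [[M FM] _] := Fs; set c := `|M| + 1.
have c0 : 0 < c by rewrite ltr_wpDl.
apply: (@stable_ext (fun t => c * Num.sqrt ((c^-1 * F t) * (c^-1 * F t)))).
  move=> t _; rewrite -expr2 sqrtr_sqr normrM ger0_norm ?invr_ge0 ?(ltW c0) //.
  by rewrite mulrA mulfV ?mul1r ?gt_eqF.
apply: stableZ; apply: stable_sqrt; first by apply: stableM; exact: stableZ.
move=> t /FM Ft; rewrite -expr2 sqr_ge0 /= -real_normK ?num_real // expr_le1 // normrM.
rewrite ger0_norm ?invr_ge0 ?(ltW c0) // mulrC ler_pdivrMr // mul1r.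
by apply: le_trans Ft _; apply: le_trans (ler_norm M) _; rewrite /c lerDl.
Qed.

Lemma cutoffE (t : R) : cutoff t = 2^-1 * (`|t| - `|t - 1| + 1).
Proof.
rewrite /cutoff; case: ifPn => [t0|]; last rewrite -ltNge => t0.
  by rewrite ler0_norm // ler0_norm; [field|lra].
case: ifPn => [t1|]; last rewrite -ltNge => t1.
  by rewrite gtr0_norm // ler0_norm; [field|lra].
by rewrite gtr0_norm // gtr0_norm; [field|lra].
Qed.

Lemma cutoff01 (t : R) : 0 <= cutoff t <= 1.
Proof.
rewrite /cutoff; case: ifPn => [_|]; first by rewrite lexx ler01.
rewrite -ltNge => /ltW t0; case: ifPn => [->|_]; first by rewrite t0.
by rewrite ler01 lexx.
Qed.

Lemma stable_cutoff F : stable K F -> stable K (fun t => cutoff (F t)).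
Proof.
move=> Fs; apply: (@stable_ext (fun t => 2^-1 * (`|F t| - `|F t - 1| + 1))).
  by move=> t _; rewrite cutoffE.
apply/stableZ/stableD; last exact: stable_cst.
apply: stableB; first exact: stable_abs.
by apply/stable_abs/stableB; last exact: stable_cst.
Qed.

Lemma stable_kappa F : stable K F -> (forall t, 0 <= F t <= 1) ->
  stable K (fun t => kappa (F t)).
Proof.
move=> Fs F01; rewrite /kappa; apply: stable_sqrt.
  by apply: stableB => //; under eq_fun do rewrite expr2; exact: stableM.
by move=> t _; have /andP[] := F01 t; move: (F t) => s s0 s1; apply/andP; nra.
Qed.

(** Stability with the unit as multiplier is uniform continuity of the functional
    calculus on bounded selfadjoint elements, uniform over all algebras. *)
Lemma stable_unif F eta : stable K F -> 0 < eta -> exists2 delta, 0 < delta &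
    forall (A : opAlgebra R) (a b : A), adj a = a -> adj b = b ->
      nrm a <= K -> nrm b <= K -> nrm (a - b) <= delta ->
      nrm (fc F a - fc F b) <= eta.
Proof.
move=> [_ Fs] /Fs[d d0 H]; exists d => // A a b ha hb aK bK abd.
have := H A a b 1 ha hb aK bK (nrm1 A); rewrite !mul1r mulr1; exact.
Qed.

End StableFunctions.

(** * Estimates for the almost projection *)

Section Estimates.
Variable R : realType.

Definition defect (t : R) : R := cutoff t - cutoff t * cutoff t.

Lemma defect_le (t : R) : `|t| <= 1 -> `|defect t| <= `|t * t - t|.
Proof.
rewrite ler_norml /defect /cutoff => /andP[tN1 t1].
case: ifPn => [t0|]; first by rewrite mul0r subrr normr0.
by rewrite t1 distrC.
Qed.

Lemma defect01 (t : R) : 0 <= defect t <= 1.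
Proof.
have /andP[] := cutoff01 t; rewrite /defect; move: (cutoff t) => s s0 s1.
by apply/andP; split; nra.
Qed.

Lemma kappa_sqr (t : R) : kappa (cutoff t) * kappa (cutoff t) = defect t.
Proof.
have /andP[d0 _] := defect01 t.
by rewrite -[LHS]expr2 /kappa sqr_sqrtr // expr2.
Qed.

Lemma kappa_cutoff_le1 (t : R) : `|kappa (cutoff t)| <= 1.
Proof.
have /andP[_ d1] := defect01 t; rewrite ger0_norm ?sqrtr_ge0 //.
by rewrite -(@expr_le1 _ 2) ?sqrtr_ge0 // expr2 kappa_sqr.
Qed.

Lemma stable_defect (K : R) : stable K defect.
Proof.
have cs : stable K (@cutoff R) by apply: (@stable_cutoff _ _ id); exact: stable_id.
by apply: stableB => //; exact: stableM.
Qed.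

Lemma fc_defect (A : opAlgebra R) (a : A) :
  fc defect a = fc (@cutoff R) a - fc (@cutoff R) a * fc (@cutoff R) a.
Proof. by rewrite /defect fcB fcM. Qed.

Lemma fc_comm (A : opAlgebra R) F (a : A) : adj a = a ->
  a * fc F a = fc F a * a.
Proof. by move=> ha; rewrite (fc_intertwine F ha ha (erefl (a * a))). Qed.

(** On the spectrum of a contraction the defect is at most |t^2 - t|. *)
Lemma nrm_defect_dist (A : opAlgebra R) (a b : A) eps : adj a = a ->
  nrm a <= 1 -> nrm ((a * a - a) * (a - b)) <= eps ->
  nrm (fc defect a * (a - b)) <= eps.
Proof.
move=> ha a1; apply: le_trans.
have E : a * a - a = fc (fun t => t * t - t) a.
  by rewrite (fcB (fun t => t * t) id) (fcM id id) fc_id.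
rewrite E; apply: fc_dominate => t /(sp_nrm ha) ta; apply: defect_le.
exact: le_trans a1.
Qed.

(** Stability of the cutoff with the multiplier k = kappa(f(a)).  The multiplier
    kills a - b because k^2 is the defect u(a), so that
    |k (a - b)|^2 <= |(a - b) u(a) (a - b)| <= 2 |u(a) (a - b)|. *)
Lemma off_diagonal_small eta : 0 < eta -> exists2 eps, 0 < eps &
  forall (A : opAlgebra R) (a b : A), adj a = a -> adj b = b ->
  nrm a <= 1 -> nrm b <= 1 -> nrm ((a * a - a) * (a - b)) <= eps ->
  nrm (fc (@kappa R \o @cutoff R) a * (fc (@cutoff R) a - fc (@cutoff R) b)) <= eta.
Proof.
move=> eta0.
have [_ /(_ eta eta0)[d d0 H]] : stable 1 (@cutoff R).
  by apply: (@stable_cutoff _ _ id); exact: stable_id.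
exists (d ^+ 2 / 2); first by rewrite divr_gt0 // exprn_gt0.
move=> A a b ha hb a1 b1 abd; apply: H => //; last 2 first.
- exact: fc_comm.
- have dd := nrm_defect_dist ha a1 abd.
  rewrite -ler_sqr ?nnegrE ?nrm_ge0 ?(ltW d0) //.
  apply: le_trans (nrm_sq _) _; rewrite adjM fc_adj adjB ha hb -!mulrA.
  rewrite [fc _ a * (fc _ a * _)]mulrA -fcM.
  rewrite (fc_ext (G := defect)); last by move=> t; exact: kappa_sqr.
  have ab2 : nrm (a - b) <= 2 by apply: le_trans (nrmB _ _) _; lra.
  by apply: le_trans (nrmM_le ab2 dd) _; rewrite mulrC divfK.
- by apply: (nrm_fc_bound ha a1) => // t _; exact: kappa_cutoff_le1.
Qed.

(** (u(a) - u(b))^2 = u(a)(u(a) - u(b)) + u(b)(u(b) - u(a)), and stability of u with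
    the multipliers u(a) and u(b) makes both terms small. *)
Lemma defects_close eta : 0 < eta -> exists2 eps, 0 < eps &
  forall (A : opAlgebra R) (a b : A), adj a = a -> adj b = b ->
  nrm a <= 1 -> nrm b <= 1 -> nrm ((a * a - a) * (a - b)) <= eps ->
  nrm ((b * b - b) * (a - b)) <= eps ->
  nrm (fc defect a - fc defect b) <= eta.
Proof.
move=> eta0; have e2 : 0 < eta ^+ 2 / 2 by rewrite divr_gt0 // exprn_gt0.
have [_ /(_ _ e2)[d d0 H]] := stable_defect 1.
exists d => // A a b ha hb a1 b1 abd; rewrite -nrmN -mulrN opprB => bad.
have D1 (c : A) : adj c = c -> nrm c <= 1 -> nrm (fc defect c) <= 1.
  move=> hc c1; apply: (nrm_fc_bound hc c1) => // t _.
  by have /andP[d1 d2] := defect01 t; rewrite ger0_norm.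
have aE := H _ _ _ _ ha hb a1 b1 (D1 _ ha a1) (fc_comm _ ha)
  (nrm_defect_dist ha a1 abd).
have bE := H _ _ _ _ hb ha b1 a1 (D1 _ hb b1) (fc_comm _ hb)
  (nrm_defect_dist hb b1 bad).
rewrite -ler_sqr ?nnegrE ?nrm_ge0 ?(ltW eta0) //.
apply: le_trans (nrm_sa_sq _) _; first by rewrite adjB !fc_adj.
rewrite mulrBl -[X in _ - X]opprK -mulrN opprB opprK.
by apply: le_trans (nrmD _ _) _; rewrite [leRHS](splitr (eta ^+ 2)) lerD.
Qed.

(** The four conclusions are about the blocks of Q - Q^2; the two off-diagonal
    ones are k (p - q) and its adjoint, as k commutes with p. *)
Lemma almost_projection_blocks eta : 0 < eta -> exists2 eps, 0 < eps &
  forall (A : opAlgebra R) (a b : A), adj a = a -> adj b = b ->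
  nrm a <= 1 -> nrm b <= 1 -> nrm ((a * a - a) * (a - b)) <= eps ->
  nrm ((b * b - b) * (a - b)) <= eps ->
  let p := fc (@cutoff R) a in let q := fc (@cutoff R) b in
  let k := fc (@kappa R) p in
  [/\ 1 - p - ((1 - p) * (1 - p) + k * k) = 0,
      nrm (k - ((1 - p) * k + k * q)) <= eta,
      nrm (k - (k * (1 - p) + q * k)) <= eta &
      nrm (q - (k * k + q * q)) <= eta].
Proof.
move=> eta0; have [e1 e10 H1] := off_diagonal_small eta0.
have [e2 e20 H2] := defects_close eta0.
exists (Num.min e1 e2); first by rewrite lt_min e10.
move=> A a b ha hb a1 b1; rewrite !le_min => /andP[ab1 ab2] /andP[_ ba2].
move=> p q k; have kE : k = fc (@kappa R \o @cutoff R) a by rewrite /k /p fc_comp.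
have kp : p * k = k * p by apply: fc_comm; exact: fc_adj.
have kk : k * k = p - p * p.
  rewrite kE -fcM -fc_defect; apply: fc_ext => t; exact: kappa_sqr.
have hkpq : nrm (k * (p - q)) <= eta by rewrite kE; exact: H1.
split.
- by rewrite kk mulrBr mulr1 mulrBl mul1r subrK subrr.
- suff -> : k - ((1 - p) * k + k * q) = k * (p - q) by [].
  by rewrite mulrBl mul1r kp mulrBr opprD opprB addrA [k + _]addrC subrK.
- suff -> : k - (k * (1 - p) + q * k) = adj (k * (p - q)) by rewrite nrm_adj.
  rewrite adjM adjB /k /p /q !fc_adj -/p -/q -/k.
  by rewrite mulrBr mulr1 -kp mulrBl opprD opprB addrA [k + _]addrC subrK.
- suff -> : q - (k * k + q * q) = - (fc defect a - fc defect b).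
    by rewrite nrmN; exact: H2.
  by rewrite !fc_defect -/p -/q kk opprB opprD addrA addrAC -addrA.
Qed.

(** Any stable function equal to 0 below 1/4 and to 1 above 3/4 would do. *)
Definition round (t : R) : R := cutoff (2 * t - 2^-1).

Lemma stable_round K : stable K round.
Proof.
apply: stable_cutoff; apply: stableB; last exact: stable_cst.
by apply: stableZ; exact: stable_id.
Qed.

(** The hypothesis puts t in [-1/4, 1/4] or in [3/4, 5/4]: the gap comes from
    (t - 1/4)(t - 3/4) >= 0, which is the same as t - t^2 <= 3/16. *)
Lemma round_close (t : R) : `|t - t * t| <= 3 / 16 ->
  `|round t - t| <= 4^-1 /\ round t * round t = round t.
Proof.
rewrite ler_norml => /andP[l u].
have [t4|t4] := lerP t (1 / 4).
  have -> : round t = 0 by rewrite /round /cutoff ifT //; lra.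
  by rewrite mul0r ler_norml; split=> //; apply/andP; split; nra.
have t34 : 3 / 4 <= t by nra.
have -> : round t = 1.
  rewrite /round /cutoff ifF; last by apply/negbTE; rewrite -ltNge; lra.
  by case: ifPn => // ?; lra.
by rewrite mul1r ler_norml; split=> //; apply/andP; split; nra.
Qed.

Lemma round_projection (A : opAlgebra R) (c : A) : adj c = c ->
  nrm (c - c * c) <= 3 / 16 ->
  [/\ nrm c <= 2, fc round c * fc round c = fc round c &
      nrm (fc round c - c) <= 4^-1].
Proof.
move=> hc cc; have spc t : sp c t -> `|t - t * t| <= 3 / 16.
  move=> /(sp_le (fun t => t - t * t)).
  by rewrite fcB (fcM id id) !(fc_id hc) => /le_trans; apply.
split.
- rewrite -(fc_id hc); apply: nrm_fc => // t /spc; rewrite !ler_norml.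
  by move=> /andP[? ?]; apply/andP; split; nra.
- by rewrite -fcM; apply: fc_ext_sp => t /spc /round_close[].
- rewrite -{2}(fc_id hc) -fcB; apply: nrm_fc => // t /spc.
  by move=> /round_close[].
Qed.

End Estimates.

(** * Matrices as an instance *)

Section MatrixAlgebra.
Variable R : realType.
Local Notation C := R[i].
#[local] Opaque l2norm opnorm fun_calc.

Lemma fun_calcD n (F G : R -> R) (A : 'M[C]_n) :
  fun_calc (fun t => F t + G t) A = fun_calc F A + fun_calc G A.
Proof.
rewrite -[fun_calc F A]scale1r -(fun_calc_lin A 1 F G).
by congr fun_calc; apply: funext => t; rewrite mul1r.
Qed.

Lemma adjB_mx n (A B : 'M[C]_n) : (A - B)^t* = A^t* - B^t*.
Proof. by rewrite linearB /= map_mxB. Qed.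

Definition mxalg (n : nat) : opAlgebra R.
Proof.
refine (@OpAlgebra R ('M[C]_n : pzRingType) (@opnorm R n) (fun M => M^t* )
  (fun c => c%:C%:M) (@fun_calc R n) (@spectrum R n)
  _ _ _ _ _ _ _ _ _ _ _ _ _ _ _ _ _ _ _ _).
- exact: opnorm_ge0.
- exact: opnormD.
- exact: opnormN.
- exact: opnormM.
- exact: opnorm_adj.
- exact: opnorm_sq_le.
- by move=> x y; exact: adjmxM.
- exact: adjB_mx.
- by [].
- exact: opnorm_scalar_le.
- exact: fun_calc_id.
- by move=> c a; exact: fun_calc_cst.
- exact: fun_calcD.
- by move=> F G a; exact: fun_calcM.
- by move=> F a; exact: fun_calc_adj.
- by move=> F G a; exact: fun_calc_comp.
- by move=> F a b x; exact: fun_calc_intertwine.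
- by move=> F G a; exact: fun_calc_ext.
- by move=> F G a x; exact: fun_calc_dominate.
- by move=> F a t; exact: spectrum_le.
Defined.

End MatrixAlgebra.

(** * Block matrices with weights *)

Section BlockMatrices.
Variable R : realType.
Local Notation C := R[i].

Lemma l2norm_col_real n (w : 'I_n -> R) :
  l2norm (\col_i (w i)%:C : 'cV[C]_n) ^+ 2 = \sum_i w i ^+ 2.
Proof.
rewrite l2norm_sqr; apply: eq_bigr => i _.
by rewrite mxE normc_real /= real_normK ?num_real.
Qed.

Lemma sum_cauchy_schwarz n (w y : 'I_n -> R) :
  \sum_i w i * y i <= Num.sqrt (\sum_i w i ^+ 2) * Num.sqrt (\sum_i y i ^+ 2).
Proof.
rewrite -!l2norm_col_real !sqrtr_sqr !ger0_norm ?l2norm_ge0 //.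
apply: le_trans (Re_cdot_le _ _); rewrite /cdot mxE Re_sum.
apply: ler_sum => i _; rewrite !mxE.
have -> : Num.Def.conjC (w i)%:C = (w i)%:C by exact: conjc_real.
by rewrite /= mul0r subr0.
Qed.

#[local] Opaque l2norm opnorm fun_calc.

Lemma l2norm_mxcol p N (u : 'I_p -> 'cV[C]_N) :
  l2norm (\mxcol_i u i) ^+ 2 = \sum_i l2norm (u i) ^+ 2.
Proof.
apply/complexI; rewrite -cdot_l2norm /cdot tr_mxcol.
have -> : map_mx Num.Def.conjC (\mxrow_i (u i)^T) = \mxrow_i ((u i)^t* ).
  by apply/matrixP => i j; rewrite !mxE.
rewrite mul_mxrow_mxcol summxE rmorph_sum /=; apply: eq_bigr => i _.
by rewrite -cdot_l2norm.
Qed.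

(** The norm is bounded by that of the matrix of the norms of the blocks, here
    dominated by c times the rank one matrix w w^T, whose norm is |w|^2. *)
Lemma opnorm_mxblock p N (B : 'I_p -> 'I_p -> 'M[C]_N) (w : 'I_p -> R) c :
  0 <= c -> (forall i, 0 <= w i) ->
  (forall i j, opnorm (B i j) <= c * (w i * w j)) ->
  opnorm (\mxblock_(i < p, j < p) B i j) <= c * \sum_i w i ^+ 2.
Proof.
move=> c0 w0 Bw; have W0 : 0 <= \sum_i w i ^+ 2.
  by apply: sumr_ge0 => i _; exact: sqr_ge0.
apply: opnorm_le => [|v]; first exact: mulr_ge0.
rewrite -[v]submxcolK; move: (fun i => submxcol v i) => {v} u.
rewrite mul_mxblock_mxrow.
set S := Num.sqrt (\sum_i l2norm (u i) ^+ 2).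
have uS : l2norm (\mxcol_j u j) = S.
  by rewrite /S -l2norm_mxcol sqrtr_sqr ger0_norm ?l2norm_ge0.
set W := Num.sqrt (\sum_i w i ^+ 2).
have H i : l2norm (\sum_j B i j *m u j) <= w i * (c * (W * S)).
  apply: le_trans (l2norm_sum _) _.
  apply: (@le_trans _ _ (\sum_j w i * (c * (w j * l2norm (u j))))).
    apply: ler_sum => j _; apply: le_trans (l2norm_mulmx _ _) _.
    rewrite [leRHS](_ : _ = c * (w i * w j) * l2norm (u j)); last by ring.
    by rewrite ler_wpM2r ?l2norm_ge0.
  rewrite -mulr_sumr -mulr_sumr ler_wpM2l // ler_wpM2l //.
  exact: sum_cauchy_schwarz.
rewrite uS -(@ler_pXn2r _ 2) ?nnegrE ?l2norm_ge0 ?mulr_ge0 ?sqrtr_ge0 //.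
rewrite l2norm_mxcol.
apply: (@le_trans _ _ (\sum_i w i ^+ 2 * (c * (W * S)) ^+ 2)).
  apply: ler_sum => i _; rewrite -exprMn ler_pXn2r ?nnegrE ?l2norm_ge0 //.
  by rewrite !mulr_ge0 ?sqrtr_ge0.
rewrite -mulr_suml -(sqr_sqrtr W0) -/W le_eqVlt; apply/orP; left; apply/eqP.
ring.
Qed.

Section Weights.
Variables (L : finType) (N : nat).
Implicit Types (w : L -> R) (D E : L -> L -> 'M[C]_N).

Definition wblock w D : 'M[C]_(bdim L N) :=
  \mxblock_(i < #|L|, j < #|L|)
    ((w (enum_val i) * w (enum_val j))%:C *: D (enum_val i) (enum_val j)).

Lemma sum_enum_val (V : nmodType) (F : L -> V) :
  \sum_(i < #|L|) F (enum_val i) = \sum_a F a.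
Proof. by rewrite -(big_enum_val F). Qed.

Lemma opnorm_wblock w D c : 0 <= c -> (forall a, 0 <= w a) ->
  \sum_a w a ^+ 2 = 1 ->
  (forall a b, w a != 0 -> w b != 0 -> opnorm (D a b) <= c) ->
  opnorm (wblock w D) <= c.
Proof.
move=> c0 w0 w1 Dc; rewrite -[leRHS]mulr1 -w1 -(sum_enum_val (fun a => w a ^+ 2)).
apply: opnorm_mxblock => // i j; set a := enum_val i; set b := enum_val j.
apply: le_trans (opnorm_scaleR_le _ _) _.
rewrite ger0_norm ?mulr_ge0 // mulrC.
have [->|a0] := eqVneq (w a) 0; first by rewrite mul0r !mulr0.
have [->|b0] := eqVneq (w b) 0; first by rewrite !mulr0.
by rewrite ler_wpM2r ?mulr_ge0 ?Dc.
Qed.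

Lemma wblock_eq w D E : (forall a b, w a != 0 -> w b != 0 -> D a b = E a b) ->
  wblock w D = wblock w E.
Proof.
move=> DE; apply: eq_mxblock => i j.
have [->|a0] := eqVneq (w (enum_val i)) 0; first by rewrite mul0r !scale0r.
have [->|b0] := eqVneq (w (enum_val j)) 0; first by rewrite mulr0 !scale0r.
by rewrite DE.
Qed.

Lemma wblockB w D E : wblock w D - wblock w E = wblock w (fun a b => D a b - E a b).
Proof. by rewrite -mxblockB; apply: eq_mxblock => i j; rewrite scalerBr. Qed.

Lemma wblock_adj w D : (wblock w D)^t* = wblock w (fun a b => (D b a)^t* ).
Proof.
rewrite tr_mxblock; apply/matrixP => s t; rewrite !mxE.
rewrite rmorphM /= mulrC [in RHS]mulrC; congr (_ * _).
by rewrite (mulrC (w _)); exact: conjc_real.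
Qed.

(** The weights of the inner index enter squared, as a probability vector. *)
Lemma wblockM w D E : wblock w D *m wblock w E =
  wblock w (fun a c => \sum_b (w b ^+ 2)%:C *: (D a b *m E b c)).
Proof.
rewrite mul_mxblock; apply: eq_mxblock => i j.
rewrite -(sum_enum_val (fun b => (w b ^+ 2)%:C *: (D _ b *m E b _))).
rewrite scaler_sumr; apply: eq_bigr => k _.
rewrite -scalemxAl -scalemxAr !scalerA -!rmorphM /=; congr (_%:C *: _).
by ring.
Qed.

Lemma opnorm_convex w (F : L -> 'M[C]_N) c : \sum_a w a ^+ 2 = 1 ->
  (forall a, w a != 0 -> opnorm (F a) <= c) ->
  opnorm (\sum_a (w a ^+ 2)%:C *: F a) <= c.
Proof.
move=> w1 Fc; apply: le_trans (opnorm_sum _) _.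
rewrite -[leRHS]mul1r -w1 mulr_suml; apply: ler_sum => a _.
apply: le_trans (opnorm_scaleR_le _ _) _; rewrite ger0_norm ?sqr_ge0 //.
have [->|a0] := eqVneq (w a) 0; first by rewrite expr0n /= !mul0r.
by rewrite ler_wpM2l ?sqr_ge0 ?Fc.
Qed.

End Weights.
End BlockMatrices.

(** * The matrix Q of two Hermitian contractions *)

Section AlmostProjection.
Variable R : realType.
Local Notation C := R[i].
#[local] Opaque l2norm opnorm fun_calc.

Lemma le_sum3 (eta x y z t : R) : x = 0 -> y <= eta / 3 -> z <= eta / 3 ->
  t <= eta / 3 -> x + y + (z + t) <= eta.
Proof. lra. Qed.

Lemma le_sum4 (eta x y z t : R) : x <= eta / 4 -> y <= eta / 4 ->
  z <= eta / 4 -> t <= eta / 4 -> x + y + (z + t) <= eta.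
Proof. lra. Qed.

Lemma le_min_and (x d e : R) : x <= Num.min d e -> x <= d /\ x <= e.
Proof. by rewrite le_min => /andP. Qed.

Definition qmx n (a b : 'M[C]_n) : 'M[C]_(n + n) :=
  let p := fun_calc (@cutoff R) a in
  let k := fun_calc (@kappa R) p in
  block_mx (1%:M - p) k k (fun_calc (@cutoff R) b).

Lemma block_mx_adj n (p q r s : 'M[C]_n) :
  (block_mx p q r s)^t* = block_mx (p^t* ) (r^t* ) (q^t* ) (s^t* ).
Proof. by rewrite tr_block_mx map_block_mx. Qed.

Lemma block_mxB n (p q r s p' q' r' s' : 'M[C]_n) :
  block_mx p q r s - block_mx p' q' r' s' =
  block_mx (p - p') (q - q') (r - r') (s - s').
Proof. by rewrite opp_block_mx add_block_mx. Qed.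

Lemma qmx_adj n (a b : 'M[C]_n) : (qmx a b)^t* = qmx a b.
Proof.
rewrite /qmx block_mx_adj; move: (fun_calc_adj a (@cutoff R))
  (fun_calc_adj b (@cutoff R)) (fun_calc_adj (fun_calc (@cutoff R) a) (@kappa R)).
move: (fun_calc (@kappa R) _) => k.
move: (fun_calc _ a) (fun_calc _ b) => p q hp hq hk.
by rewrite hq hk adjB_mx hp trmx1 map_mx1.
Qed.

Lemma qmx_almost_projection eta : 0 < eta -> exists2 eps, 0 < eps &
  forall n (a b : 'M[C]_n), a^t* = a -> b^t* = b ->
  opnorm a <= 1 -> opnorm b <= 1 ->
  opnorm ((a *m a - a) *m (a - b)) <= eps ->
  opnorm ((b *m b - b) *m (a - b)) <= eps ->
  opnorm (qmx a b - qmx a b *m qmx a b) <= eta.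
Proof.
move=> eta0; have e3 : 0 < eta / 3 by rewrite divr_gt0.
have [eps eps0 H] := almost_projection_blocks e3; exists eps; first exact: eps0.
move=> n a b ha hb a1 b1 aab bab.
have := H (mxalg R n) a b ha hb a1 b1 aab bab.
rewrite /qmx /=.
move: (fun_calc (@kappa R) _) => k; move: (fun_calc _ a) (fun_calc _ b) => p q.
move=> [h1 h2 h3 h4]; rewrite mulmx_block block_mxB.
have h1' : 1%:M - p - ((1%:M - p) *m (1%:M - p) + k *m k) = 0 by exact: h1.
have h2' : opnorm (k - ((1%:M - p) *m k + k *m q)) <= eta / 3 by exact: h2.
have h3' : opnorm (k - (k *m (1%:M - p) + q *m k)) <= eta / 3 by exact: h3.
have h4' : opnorm (q - (k *m k + q *m q)) <= eta / 3 by exact: h4.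
rewrite h1'; move: (k - (_ + _)) h2' (k - (_ + _)) h3' (q - _) h4' => X X1 Y Y1 Z Z1.
apply: le_trans (opnorm_block _ _ _ _) _.
exact: (le_sum3 (opnorm0 _ _) X1 Y1 Z1).
Qed.

Lemma qmx_unif eta : 0 < eta -> exists2 delta, 0 < delta &
  forall n (a b a' b' : 'M[C]_n), a^t* = a -> b^t* = b -> a'^t* = a' -> b'^t* = b' ->
  opnorm a <= 1 -> opnorm b <= 1 -> opnorm a' <= 1 -> opnorm b' <= 1 ->
  opnorm (a - a') <= delta -> opnorm (b - b') <= delta ->
  opnorm (qmx a b - qmx a' b') <= eta.
Proof.
move=> eta0; have e4 : 0 < eta / 4 by rewrite divr_gt0.
have cs : stable 1 (@cutoff R) by apply: (@stable_cutoff _ _ id); exact: stable_id.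
have ks : stable 1 (fun t : R => @kappa R (@cutoff R t)).
  exact: (@stable_kappa R 1 (@cutoff R) cs (@cutoff01 R)).
have [d1 d10 H1] := stable_unif cs e4; have [d2 d20 H2] := stable_unif ks e4.
exists (Num.min d1 d2); first by rewrite lt_min d10.
move=> n a b a' b' ha hb ha' hb' a1 b1 a1' b1'.
move: (H1 (mxalg R n) a a' ha ha' a1 a1') (H1 (mxalg R n) b b' hb hb' b1 b1')
  (H2 (mxalg R n) a a' ha ha' a1 a1'); rewrite /= => pa pb ka.
move=> /le_min_and[/pa{}pa /ka{}ka] /le_min_and[/pb{}pb _].
rewrite /qmx /= !fun_calc_comp block_mxB.
apply: le_trans (opnorm_block _ _ _ _) _; apply: (le_sum4 _ ka ka pb).
have -> : 1%:M - fun_calc (@cutoff R) a - (1%:M - fun_calc (@cutoff R) a') =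
  - (fun_calc (@cutoff R) a - fun_calc (@cutoff R) a').
  by rewrite opprB addrC subrKA opprB.
exact: (le_congr (opnormN _) (erefl _) pa).
Qed.

End AlmostProjection.

(** * The matrices A of a generalized pair *)

Section Cocycles.
Variables (R : realType) (X : topologicalType) (L : finType) (U : L -> set X).
Variable N : nat.
Local Notation C := R[i].
Implicit Types (phi psi : L -> X -> R) (g : L -> L -> X -> 'M[C]_N).
#[local] Opaque l2norm opnorm fun_calc.

Lemma pou_supp phi a x : partition_of_unity U phi -> phi a x != 0 -> U a x.
Proof. by case=> _ _ supp _ ax; apply: (supp a); apply: subset_closure. Qed.

Lemma pou_ge0 phi a x : partition_of_unity U phi -> 0 <= phi a x.
Proof. by case=> _ /(_ a x)/andP[]. Qed.

Lemma pou_sum phi x : partition_of_unity U phi -> \sum_a phi a x ^+ 2 = 1.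
Proof. by case. Qed.

(** The weights vanish where the transition maps are undefined. *)
Lemma Amx_entry phi g a b x : partition_of_unity U phi ->
  (if x \in U a `&` U b then (phi a x * phi b x)%:C *: g a b x else 0) =
  (phi a x * phi b x)%:C *: g a b x.
Proof.
move=> pou; case: ifPn => // /negP xU.
have [->|a0] := eqVneq (phi a x) 0; first by rewrite mul0r scale0r.
have [->|b0] := eqVneq (phi b x) 0; first by rewrite mulr0 scale0r.
by case: xU; rewrite inE; split; exact: (pou_supp pou).
Qed.

Lemma Amx_wblock phi g x : partition_of_unity U phi ->
  Amx U phi g x = wblock (phi^~ x) (fun a b => g a b x).
Proof. by move=> pou; apply: eq_mxblock => i j; exact: Amx_entry. Qed.

Lemma Amx_adj phi g x : partition_of_unity U phi -> transition_maps U g ->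
  (Amx U phi g x)^t* = Amx U phi g x.
Proof.
move=> pou [_ gu gi]; rewrite (Amx_wblock g x pou) wblock_adj.
apply: wblock_eq => a b /(pou_supp pou) Ua /(pou_supp pou) Ub.
by rewrite (gi a b x) // (invmx_unitary (gu _ _ _ _)).
Qed.

Lemma Amx_le1 phi g x : partition_of_unity U phi -> transition_maps U g ->
  opnorm (Amx U phi g x) <= 1.
Proof.
move=> pou [_ gu gi]; rewrite (Amx_wblock g x pou).
apply: opnorm_wblock => //; [by move=> a; exact: pou_ge0|exact: pou_sum|].
move=> a b /(pou_supp pou) Ua /(pou_supp pou) Ub.
by apply: opnorm_unitary; exact: gu.
Qed.

(** Write both g_ac = sum_b phi_b^2 g_ac and the product of block matrices as
    averages; each block is then an average over b and c of small matrices. *)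
Lemma Amx_defect phi g gp gm x eps : partition_of_unity U phi -> 0 <= eps ->
  (forall a b c d, U a x -> U b x -> U c x -> U d x ->
     opnorm ((g a b x *m g b c x - g a c x) *m (gp c d x - gm c d x)) < eps) ->
  opnorm ((Amx U phi g x *m Amx U phi g x - Amx U phi g x)
    *m (Amx U phi gp x - Amx U phi gm x)) <= eps.
Proof.
move=> pou eps0 H; rewrite !(Amx_wblock _ x pou) wblockM !wblockB wblockM.
have w1 := pou_sum x pou.
apply: opnorm_wblock => //; first by move=> a; exact: pou_ge0.
move=> a d /(pou_supp pou) Ua /(pou_supp pou) Ud.
apply: opnorm_convex => // c /(pou_supp pou) Uc.
have -> : g a c x = \sum_b (phi b x ^+ 2)%:C *: g a c x.
  by rewrite -scaler_suml -rmorph_sum w1 scale1r.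
rewrite -sumrB mulmx_suml.
under eq_bigr do rewrite -scalerBr -scalemxAl.
apply: opnorm_convex => // b /(pou_supp pou) Ub.
by apply: ltW; exact: H.
Qed.

Lemma prod_close (a b a' b' tau : R) : 0 <= a <= 1 -> 0 <= b <= 1 ->
  0 <= a' <= 1 -> 0 <= b' <= 1 -> `|a - a'| <= tau -> `|b - b'| <= tau ->
  `|a * b - a' * b'| <= 2 * tau.
Proof.
move=> /andP[a0 a1] /andP[b0 b1] /andP[a0' a1'] /andP[b0' b1'] aa bb.
have -> : a * b - a' * b' = a * (b - b') + (a - a') * b' by ring.
have -> : 2 * tau = tau + tau by ring.
apply: le_trans (ler_normD _ _) _; rewrite !normrM.
apply: lerD; first by rewrite (ger0_norm a0); apply: le_trans bb; rewrite ler_piMl.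
by rewrite (ger0_norm b0'); apply: le_trans aa; rewrite ler_piMr.
Qed.

Lemma Amx_close phi psi g x tau : 0 <= tau -> partition_of_unity U phi ->
  partition_of_unity U psi -> transition_maps U g ->
  (forall a, `|phi a x - psi a x| <= tau) ->
  opnorm (Amx U phi g x - Amx U psi g x) <= 2 * tau * #|L|%:R.
Proof.
move=> tau0 pou pou' [_ gu _] close.
have -> : #|L|%:R = \sum_(i < #|L|) 1 ^+ 2 :> R.
  by rewrite expr1n sumr_const card_ord.
rewrite (Amx_wblock g x pou) (Amx_wblock g x pou') /wblock -mxblockB.
apply: opnorm_mxblock => // [|i j]; first by rewrite mulr_ge0.
move: (enum_val i) (enum_val j) => a b.
rewrite -scalerBl -rmorphB /= !mulr1; apply: le_trans (opnorm_scaleR_le _ _) _.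
have [_ p01 _ _] := pou; have [_ p01' _ _] := pou'.
have H := prod_close (p01 a x) (p01 b x) (p01' a x) (p01' b x) (close a) (close b).
have [/andP[/asboolP Ua /asboolP Ub]|] := boolP (`[< U a x >] && `[< U b x >]).
  apply: (le_trans (ler_wpM2l (normr_ge0 _) (opnorm_unitary (gu a b x _)))) => //.
  by rewrite mulr1.
move=> nU; have z (f : L -> X -> R) : partition_of_unity U f -> f a x * f b x = 0.
  move=> pf; have [->|a0] := eqVneq (f a x) 0; first by rewrite mul0r.
  have [->|b0] := eqVneq (f b x) 0; first by rewrite mulr0.
  by case/negP: nU; apply/andP; split; apply/asboolP; exact: pou_supp pf _.
by rewrite !z // subrr normr0 mul0r mulr_ge0.
Qed.

End Cocycles.

(** * Continuity of matrix operations *)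

Section MatrixContinuity.
Variables (K : numFieldType) (X : topologicalType).
Implicit Types (x : X).

Lemma mx_cvg (T : topologicalType) p q (F : X -> 'M[T]_(p, q)) x :
  (forall i j, (fun y => F y i j) @ x --> F x i j) -> F @ x --> F x.
Proof.
move=> H A [P FxP PA].
have H' (ij : 'I_p * 'I_q) : \forall y \near x, P ij.1 ij.2 (F y ij.1 ij.2).
  exact: H (FxP _ _).
have := filter_forall (nbhs_filter x) H'; apply: filterS => y Py.
by apply: PA => i j; exact: (Py (i, j)).
Qed.

Lemma mx_cvg_coord p q (F : X -> 'M[K]_(p, q)) x i j :
  F @ x --> F x -> (fun y => F y i j) @ x --> F x i j.
Proof. move=> Fx; apply: (@cvg_comp _ _ _ F (fun M : 'M[K]_(p, q) => M i j) _ _ _ Fx).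
exact: coord_continuous. Qed.

Lemma cstmx_cvg p q (M : 'M[K]_(p, q)) x : (fun _ : X => M) @ x --> M.
Proof. exact: cvg_cst. Qed.

Lemma cvg_sumr (I : finType) (F : I -> X -> K) x :
  (forall i, F i @ x --> F i x) ->
  (fun y => \sum_i F i y) @ x --> \sum_i F i x.
Proof.
by move=> H; apply: cvg_big => [|i _]; [exact: add_continuous|exact: H].
Qed.

Lemma cvg_prodr (I : finType) (F : I -> X -> K) x :
  (forall i, F i @ x --> F i x) ->
  (fun y => \prod_i F i y) @ x --> \prod_i F i x.
Proof.
by move=> H; apply: cvg_big => [|i _]; [exact: mul_continuous|exact: H].
Qed.

Lemma mulmx_cvg p q r (F : X -> 'M[K]_(p, q)) (G : X -> 'M[K]_(q, r)) x :
  F @ x --> F x -> G @ x --> G x -> (fun y => F y *m G y) @ x --> F x *m G x.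
Proof.
move=> Fx Gx; apply: (@mx_cvg _ _ _ (fun y => F y *m G y)) => i j.
under eq_fun do rewrite mxE; rewrite mxE.
apply: (@cvg_sumr _ (fun k y => F y i k * G y k j)) => k.
by apply: cvgM; exact: mx_cvg_coord.
Qed.

Lemma addmx_cvg p q (F G : X -> 'M[K]_(p, q)) x :
  F @ x --> F x -> G @ x --> G x -> (fun y => F y + G y) @ x --> F x + G x.
Proof.
move=> Fx Gx; apply: (@mx_cvg _ _ _ (fun y => F y + G y)) => i j.
under eq_fun do rewrite mxE; rewrite mxE.
by apply: cvgD; exact: mx_cvg_coord.
Qed.

Lemma submx_cvg p q (F G : X -> 'M[K]_(p, q)) x :
  F @ x --> F x -> G @ x --> G x -> (fun y => F y - G y) @ x --> F x - G x.
Proof.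
move=> Fx Gx; apply: (@mx_cvg _ _ _ (fun y => F y - G y)) => i j.
under eq_fun do rewrite 2!mxE; rewrite 2!mxE.
by apply: cvgB; exact: mx_cvg_coord.
Qed.

Lemma det_cvg n (F : X -> 'M[K]_n) x :
  F @ x --> F x -> (fun y => \det (F y)) @ x --> \det (F x).
Proof.
move=> Fx; rewrite /determinant.
apply: (@cvg_sumr 'S_n (fun (s : 'S_n) y => (-1) ^+ s * \prod_i F y i (s i))).
move=> s.
apply: cvgM; first exact: cvg_cst.
by apply: (@cvg_prodr _ (fun i y => F y i (s i))) => i; exact: mx_cvg_coord.
Qed.

Lemma invmx_cvg n (F : X -> 'M[K]_n) x : (forall y, F y \in unitmx) ->
  F @ x --> F x -> (fun y => invmx (F y)) @ x --> invmx (F x).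
Proof.
move=> Fu Fx; have E y : invmx (F y) = (\det (F y))^-1 *: \adj (F y).
  by rewrite /invmx Fu.
under eq_fun do rewrite E; rewrite E.
apply: (@mx_cvg _ _ _ (fun y => (\det (F y))^-1 *: \adj (F y))) => i j.
under eq_fun do rewrite 2!mxE; rewrite 2!mxE.
apply: cvgM.
  apply: cvgV; last exact: det_cvg.
  by have := Fu x; rewrite unitmxE unitfE.
rewrite /cofactor; apply: cvgM; first exact: cvg_cst.
apply: (@det_cvg _ (fun y => row' j (col' i (F y)))).
apply: (@mx_cvg _ _ _ (fun y => row' j (col' i (F y)))) => k l.
under eq_fun do rewrite 2!mxE; rewrite 2!mxE.
exact: mx_cvg_coord.
Qed.

Lemma mx_cvg_norm p q (F : X -> 'M[K]_(p, q)) x :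
  (forall e, 0 < e -> \forall y \near x, forall i j, `|F x i j - F y i j| <= e) ->
  F @ x --> F x.
Proof.
move=> H; apply: mx_cvg => i j; apply/cvgrPdist_le => e /H.
by apply: filterS => y; exact.
Qed.

Lemma mx_cvg_normP p q (F : X -> 'M[K]_(p, q)) x e : 0 < e -> F @ x --> F x ->
  \forall y \near x, forall i j, `|F x i j - F y i j| <= e.
Proof.
move=> e0 Fx; have H (ij : 'I_p * 'I_q) :
    \forall y \near x, `|F x ij.1 ij.2 - F y ij.1 ij.2| <= e.
  by have /cvgrPdist_le/(_ e e0) := @mx_cvg_coord _ _ F x ij.1 ij.2 Fx.
have := filter_forall (nbhs_filter x) H; apply: filterS => y Py i j.
exact: (Py (i, j)).
Qed.

End MatrixContinuity.

(** * The operator norm induces the product topology *)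

Section OpnormTopology.
Variables (R : realType) (X : topologicalType).
Local Notation C := R[i].
#[local] Opaque l2norm opnorm.

Lemma opnorm_entry n (A : 'M[C]_n) i j : complex.Re `|A i j| <= opnorm A.
Proof.
have := l2norm_mulmx A (delta_mx j 0); rewrite l2norm_delta mulr1; apply: le_trans.
by rewrite -colE; apply: le_trans (l2norm_coord _ i); rewrite mxE.
Qed.

Lemma l2norm_le_sum n (v : 'cV[C]_n) : l2norm v <= \sum_i complex.Re `|v i 0|.
Proof.
have {1}-> : v = \sum_i v i 0 *: delta_mx i 0.
  by rewrite {1}[v]matrix_sum_delta; apply: eq_bigr => i _; rewrite big_ord1.
apply: le_trans (l2norm_sum _) _; apply: ler_sum => i _.
by rewrite l2normZ l2norm_delta mulr1.
Qed.

Lemma opnorm_le_sum n (A : 'M[C]_n) :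
  opnorm A <= \sum_i \sum_j complex.Re `|A i j|.
Proof.
apply: opnorm_le => [|v].
  by apply: sumr_ge0 => i _; apply: sumr_ge0 => j _; exact: Re_norm_ge0.
apply: le_trans (l2norm_le_sum _) _; rewrite mulr_suml; apply: ler_sum => i _.
rewrite mxE mulr_suml -lecR -normCE rmorph_sum /=.
apply: le_trans (ler_norm_sum _ _ _) _; apply: ler_sum => j _.
rewrite normrM normCE [`|v j 0|]normCE -rmorphM /= lecR.
by rewrite ler_wpM2l ?Re_norm_ge0 // l2norm_coord.
Qed.

Lemma opnorm_near n (F : X -> 'M[C]_n) x e : 0 < e -> F @ x --> F x ->
  \forall y \near x, opnorm (F y - F x) <= e.
Proof.
move=> e0 Fx; set d := e / (n * n).+1%:R.
have d0 : 0 < d by rewrite divr_gt0.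
have d0' : 0 < d%:C :> C by rewrite ltcR.
have := @mx_cvg_normP C X n n F x _ d0' Fx; apply: filterS => y Fy.
apply: le_trans (opnorm_le_sum _) _.
apply: (@le_trans _ _ (\sum_(i < n) \sum_(j < n) d)).
  apply: ler_sum => i _; apply: ler_sum => j _.
  by rewrite 2!mxE -lecR -normCE distrC.
rewrite !sumr_const card_ord -mulrnA -mulr_natr /d mulrAC ler_pdivrMr //.
by rewrite ler_wpM2l ?(ltW e0) // ler_nat.
Qed.

Lemma opnorm_cvg n (F : X -> 'M[C]_n) x :
  (forall e : R, 0 < e -> \forall y \near x, opnorm (F y - F x) <= e) ->
  F @ x --> F x.
Proof.
move=> H; apply: (@mx_cvg_norm C X n n F x) => e e0.
have [r Er] : exists r, e = r%:C by apply/complex_realP/ger0_real/ltW.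
move: e0; rewrite Er ltcR => r0; have := H r r0; apply: filterS => y Fy i j.
rewrite distrC normCE lecR; apply: le_trans Fy.
by have := opnorm_entry (F y - F x) i j; rewrite 2!mxE.
Qed.

End OpnormTopology.

(** * Conjugate projections and isomorphic bundles *)

Section ConjugateProjections.
Variables (R : realType) (X : topologicalType).
Local Notation C := R[i].
#[local] Opaque l2norm opnorm.

Lemma unitmx_inj n (A : 'M[C]_n) :
  (forall v : 'cV[C]_n, A *m v = 0 -> v = 0) -> A \in unitmx.
Proof.
move=> inj; rewrite -unitmx_tr -row_free_unit -kermx_eq0.
apply/rowV0P => v /sub_kermxP vA; rewrite -[v]trmxK.
by rewrite (inj v^T) ?trmx0 // -[A]trmxK -trmx_mul vA trmx0.
Qed.

Lemma contraction_fix n (M : 'M[C]_n) (v : 'cV[C]_n) : opnorm M < 1 -> M *m v = v -> v = 0.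
Proof.
move=> M1 Mv; apply: l2norm_eq0.
have := l2norm_mulmx M v; rewrite Mv.
move: (l2norm_ge0 v) (opnorm_ge0 M) M1; move: (l2norm v) (opnorm M) => a b.
by move=> a0 b0 b1 ab; apply/eqP; rewrite eq_le a0 andbT; nra.
Qed.

(** It maps the image of P to that of P', and the kernel of P to that of P'. *)
Definition intertwiner n (P P' : 'M[C]_n) : 'M[C]_n :=
  P' *m P + (1%:M - P') *m (1%:M - P).

Lemma idem_compl n (P : 'M[C]_n) : P *m P = P ->
  P *m (1%:M - P) = 0 /\ (1%:M - P) *m P = 0.
Proof. by move=> PP; rewrite mulmxBr mulmxBl mulmx1 mul1mx PP subrr. Qed.

Lemma intertwinerE n (P P' : 'M[C]_n) : P *m P = P -> P' *m P' = P' ->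
  intertwiner P P' *m P = P' *m intertwiner P P'.
Proof.
move=> PP PP'; have [_ h] := idem_compl PP; have [h' _] := idem_compl PP'.
rewrite /intertwiner mulmxDl (mulmxDr P' (P' *m P)) -!mulmxA PP h mulmx0 addr0.
by rewrite !mulmxA PP' h' mul0mx addr0.
Qed.

(** If the intertwiner kills v, then so do P' P and (1 - P')(1 - P).  Thus P v is
    fixed by P - P' and vanishes, and then v = (1 - P) v is fixed by P' - P. *)
Lemma intertwiner_unit n (P P' : 'M[C]_n) : P *m P = P -> P' *m P' = P' ->
  opnorm (P - P') < 1 -> intertwiner P P' \in unitmx.
Proof.
move=> PP PP' close; apply: unitmx_inj => v Zv.
have [h _] := idem_compl PP; have [h' _] := idem_compl PP'.
have e1 : P' *m (P *m v) = 0.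
  have : P' *m (intertwiner P P' *m v) = 0 by rewrite Zv mulmx0.
  by rewrite /intertwiner mulmxA (mulmxDr P' (P' *m P)) !mulmxA PP' h' mul0mx addr0 -mulmxA.
have Pv : P *m v = 0.
  by apply: (contraction_fix close); rewrite mulmxBl e1 subr0 mulmxA PP.
have e2 : (1%:M - P') *m v = 0.
  move: Zv; rewrite /intertwiner mulmxDl -!mulmxA e1 add0r.
  by rewrite (mulmxBl 1%:M P v) mul1mx Pv subr0.
apply: (@contraction_fix _ (P' - P)); first by rewrite opnorm_distC.
by rewrite mulmxBl Pv subr0; apply/eqP; rewrite eq_sym -subr_eq0 -{1}[v]mul1mx -mulmxBl e2.
Qed.

Definition conjugate n (P P' : X -> 'M[C]_n) : Prop :=
  exists S : X -> 'M[C]_n, [/\ continuous S, forall x, S x \in unitmx &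
    forall x, S x *m P x = P' x *m S x].

Lemma conjugate_trans n (P P' P'' : X -> 'M[C]_n) :
  conjugate P P' -> conjugate P' P'' -> conjugate P P''.
Proof.
move=> [S [Sc Su SP]] [T [Tc Tu TP]]; exists (fun x => T x *m S x); split.
- by move=> x; exact: (@mulmx_cvg C X n n n T S x (Tc x) (Sc x)).
- by move=> x; rewrite unitmx_mul Su Tu.
- by move=> x; rewrite -mulmxA SP !mulmxA TP.
Qed.

Lemma conjugate_close n (P P' : X -> 'M[C]_n) : projection P -> projection P' ->
  (forall x, opnorm (P x - P' x) < 1) -> conjugate P P'.
Proof.
move=> [Pc PP] [P'c PP'] close; exists (fun x => intertwiner (P x) (P' x)).
have idP x : P x *m P x = P x by have [_ <-] := PP x.
have idP' x : P' x *m P' x = P' x by have [_ <-] := PP' x.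
split; [|by move=> x; exact: intertwiner_unit|by move=> x; exact: intertwinerE].
have cst1 x := @cstmx_cvg C X n n 1%:M x.
move=> x; rewrite /intertwiner.
have c1 := @mulmx_cvg C X n n n P' P x (P'c x) (Pc x).
have c2 := @submx_cvg C X n n (fun=> 1%:M) P x (cst1 x) (Pc x).
have c3 := @submx_cvg C X n n (fun=> 1%:M) P' x (cst1 x) (P'c x).
have c4 := @mulmx_cvg C X n n n (fun y => 1%:M - P' y) (fun y => 1%:M - P y) x c3 c2.
exact: (@addmx_cvg C X n n (fun y => P' y *m P y)
  (fun y => (1%:M - P' y) *m (1%:M - P y)) x c1 c4).
Qed.

Lemma action_continuous n (S : X -> 'M[C]_n) : continuous S ->
  continuous (fun p : X * 'cV[C]_n => (p.1, S p.1 *m p.2)).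
Proof.
move=> Sc p.
have c1 : (fun q : X * 'cV[C]_n => S q.1) @ p --> S p.1.
  exact: (@cvg_comp _ _ _ (fun q : X * 'cV[C]_n => q.1) S (nbhs p) (nbhs p.1)
    (nbhs (S p.1)) cvg_fst (Sc p.1)).
have c2 : (fun q : X * 'cV[C]_n => q.2) @ p --> p.2 by exact: cvg_snd.
have c3 := @mulmx_cvg C (X * 'cV[C]_n)%type n n 1 (fun q => S q.1) (fun q => q.2)
  p c1 c2.
have c0 : (fun q : X * 'cV[C]_n => q.1) @ p --> p.1 by exact: cvg_fst.
exact: (cvg_pair c0 c3).
Qed.

Lemma conjugate_bundle_iso n (P P' : X -> 'M[C]_n) : conjugate P P' ->
  bundle_iso (image_bundle P) (image_bundle P').
Proof.
move=> [S [Sc Su SP]].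
have Sc' : continuous (fun x => invmx (S x)).
  by move=> x; exact: (@invmx_cvg C X n S x Su (Sc x)).
exists (fun p => (p.1, S p.1 *m p.2)), (fun p => (p.1, invmx (S p.1) *m p.2)).
split.
- have H := continuous_subspaceT (A := image_bundle P) (action_continuous Sc).
  have H' := continuous_subspaceT (A := image_bundle P') (action_continuous Sc').
  by split; [exact: H|exact: H'].
- move=> [x v] [w /= ->]; split; last by rewrite mulKmx.
  by exists (S x *m w) => /=; rewrite mulmxA SP mulmxA.
- move=> [x v] [w /= ->]; split; last by rewrite mulKVmx.
  exists (invmx (S x) *m w) => /=.
  by apply: (can_inj (mulKmx (Su x))); rewrite mulKVmx // mulmxA SP -mulmxA mulKVmx.
- by [].
- by move=> x u v c _ _ /=; rewrite mulmxDr scalemxAr.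
Qed.

End ConjugateProjections.

(** * Continuity of Q and of its rounding *)

Section ContinuityOfQ.
Variables (R : realType) (X : topologicalType) (L : finType) (U : L -> set X).
Variable N : nat.
Local Notation C := R[i].
Implicit Types (phi psi : L -> X -> R) (g : L -> L -> X -> 'M[C]_N).
#[local] Opaque l2norm opnorm fun_calc.

Lemma real_complex_cvg (f : X -> R) x : f @ x --> f x ->
  (fun y => (f y)%:C : C) @ x --> ((f x)%:C : C).
Proof.
move=> fx; apply/cvgrPdist_le => e e0.
have [r Er] : exists r, e = r%:C by apply/complex_realP/ger0_real/ltW.
move: e0; rewrite Er ltcR => r0.
have /cvgrPdist_le/(_ r r0) := fx; apply: filterS => y fy.
by rewrite -rmorphB normc_real lecR.
Qed.

Lemma pou_vanish phi a x : partition_of_unity U phi -> ~ U a x ->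
  \forall y \near x, phi a y = 0.
Proof.
move=> [_ _ supp _] nU.
have : nbhs x (~` closure [set y | phi a y != 0]).
  apply: open_nbhs_nbhs; split; first exact/closed_openC/closed_closure.
  by move=> /supp.
apply: filterS => y ny; apply/eqP; apply: contrapT => /negP y0.
by apply: ny; exact: subset_closure.
Qed.

(** At a point of U_a and U_b the entry is a product of continuous functions; at
    any other point one of the two weights vanishes in a whole neighbourhood,
    because its closed support lies in the open set. *)
Lemma weighted_entry_cvg phi g a b k l x : (forall a, open (U a)) ->
  partition_of_unity U phi -> transition_maps U g ->
  (fun y => (phi a y * phi b y)%:C * g a b y k l) @ x -->
    (phi a x * phi b x)%:C * g a b x k l.
Proof.
move=> oU pou [gc _ _].
have van c : ~ U c x -> (forall y, phi c y = 0 -> phi a y * phi b y = 0) ->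
    (fun y => (phi a y * phi b y)%:C * g a b y k l) @ x -->
      (phi a x * phi b x)%:C * g a b x k l.
  move=> /(pou_vanish pou) H E.
  have xE := nbhs_singleton H; rewrite (E x xE) mul0r.
  apply: cvg_near_cst; apply: filterS H => y /E ->.
  by rewrite mul0r.
have [Ua|nUa] := pselect (U a x); last first.
  by apply: (van a nUa) => y ->; rewrite mul0r.
have [Ub|nUb] := pselect (U b x); last first.
  by apply: (van b nUb) => y ->; rewrite mulr0.
have gx : g a b @ x --> g a b x.
  have := gc a b; rewrite continuous_open_subspace; last exact: openI.
  by apply; rewrite inE.
have [pc _ _ _] := pou.
apply: cvgM; first by apply: real_complex_cvg; apply: cvgM; exact: pc.
exact: (@mx_cvg_coord C X N N (g a b) x k l gx).
Qed.

Lemma Amx_continuous phi g : (forall a, open (U a)) ->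
  partition_of_unity U phi -> transition_maps U g -> continuous (Amx U phi g).
Proof.
move=> oU pou tg x; apply: (@mx_cvg X C _ _ (Amx U phi g)) => s t.
have E y : Amx U phi g y s t =
    (phi (enum_val (tagnat.sig1 s)) y * phi (enum_val (tagnat.sig1 t)) y)%:C *
    g (enum_val (tagnat.sig1 s)) (enum_val (tagnat.sig1 t)) y
      (tagnat.sig2 s) (tagnat.sig2 t).
  by rewrite (Amx_wblock g y pou) !mxE.
under eq_fun do rewrite E; rewrite E; exact: weighted_entry_cvg.
Qed.

End ContinuityOfQ.

Section Rounding.
Variables (R : realType) (X : topologicalType) (L : finType) (U : L -> set X).
Variables (N : nat) (gp gm : L -> L -> X -> 'M[R[i]]_N).
Hypotheses (oU : forall a, open (U a)) (tp : transition_maps U gp)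
  (tm : transition_maps U gm).
Local Notation C := R[i].
#[local] Opaque l2norm opnorm fun_calc.
Local Notation Q phi := (Qmx U phi gp gm).

Lemma Qmx_qmx phi x : Q phi x = qmx (Amx U phi gp x) (Amx U phi gm x).
Proof. by []. Qed.

Lemma Qmx_continuous phi : partition_of_unity U phi -> continuous (Q phi).
Proof.
move=> pou x; apply: opnorm_cvg => e e0.
have [d d0 H] := qmx_unif e0.
have np := opnorm_near d0 (@Amx_continuous _ _ _ _ _ phi gp oU pou tp x).
have nm := opnorm_near d0 (@Amx_continuous _ _ _ _ _ phi gm oU pou tm x).
apply: filterS2 np nm => y yp ym; rewrite !Qmx_qmx.
by apply: H => //; first [exact: Amx_adj|exact: Amx_le1].
Qed.

Lemma round_continuous n (F : X -> 'M[C]_n) : continuous F ->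
  (forall x, (F x)^t* = F x) -> (forall x, opnorm (F x) <= 2) ->
  continuous (fun x => fun_calc (@round R) (F x)).
Proof.
move=> Fc hF F2 x; apply: (@opnorm_cvg R X n (fun x => fun_calc (@round R) (F x))).
move=> e e0; have [d d0 H] := stable_unif (@stable_round R 2) e0.
have := opnorm_near d0 (Fc x); apply: filterS => y yx.
exact: (H (mxalg R n) (F y) (F x) (hF y) (hF x) (F2 y) (F2 x) yx).
Qed.

Definition rounded phi x := fun_calc (@round R) (Q phi x).

Hypothesis almost : forall phi x, partition_of_unity U phi ->
  opnorm (Q phi x - Q phi x *m Q phi x) <= 3 / 16.

Lemma rounded_facts phi x : partition_of_unity U phi ->
  [/\ opnorm (Q phi x) <= 2, rounded phi x *m rounded phi x = rounded phi x &
      opnorm (rounded phi x - Q phi x) <= 4^-1].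
Proof.
move=> pou; have hQ : (Q phi x)^t* = Q phi x by exact: qmx_adj.
have [] := @round_projection R (mxalg R _) (Q phi x) hQ (almost x pou).
by move=> h1 h2 h3; split; [exact: h1|exact: h2|exact: h3].
Qed.

Lemma rounded_projection phi : partition_of_unity U phi -> projection (rounded phi).
Proof.
move=> pou; split.
  apply: round_continuous; first exact: Qmx_continuous.
    by move=> x; exact: qmx_adj.
  by move=> x; have [] := rounded_facts x pou.
move=> x; have [_ h _] := rounded_facts x pou; split; last by rewrite h.
by rewrite /rounded fun_calc_adj.
Qed.

End Rounding.

(** * Paths of partitions of unity *)

Section Path.
Variables (R : realType) (X : topologicalType) (L : finType) (U : L -> set X).
Implicit Types (phi psi : L -> X -> R).

(** The squares are interpolated, so that the sum of squares stays 1. *)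
Definition pou_path phi psi (s : R) (a : L) (x : X) : R :=
  Num.sqrt ((1 - s) * phi a x ^+ 2 + s * psi a x ^+ 2).

Lemma convex01 (s u v : R) : 0 <= s <= 1 -> 0 <= u <= 1 -> 0 <= v <= 1 ->
  0 <= (1 - s) * u + s * v <= 1.
Proof.
move=> /andP[s0 s1] /andP[u0 u1] /andP[v0 v1]; apply/andP; split.
  by rewrite addr_ge0 ?mulr_ge0 ?subr_ge0.
have : (1 - s) * u <= (1 - s) * 1 by rewrite ler_wpM2l ?subr_ge0.
have : s * v <= s * 1 by rewrite ler_wpM2l.
lra.
Qed.

Lemma sqr01 (u : R) : 0 <= u <= 1 -> 0 <= u ^+ 2 <= 1.
Proof. by move=> /andP[u0 u1]; rewrite sqr_ge0 expr_le1. Qed.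

Lemma pou_path_pou phi psi s : 0 <= s <= 1 -> partition_of_unity U phi ->
  partition_of_unity U psi -> partition_of_unity U (pou_path phi psi s).
Proof.
move=> s01 [fc f01 fs f1] [pc p01 ps p1].
have in01 a x := convex01 s01 (sqr01 (f01 a x)) (sqr01 (p01 a x)).
split.
- move=> a x; apply: (@cvg_comp _ _ _
    (fun y => (1 - s) * phi a y ^+ 2 + s * psi a y ^+ 2) Num.sqrt _
    (nbhs ((1 - s) * phi a x ^+ 2 + s * psi a x ^+ 2))); last exact: sqrt_continuous.
  apply: cvgD; apply: cvgM; try exact: cvg_cst.
    by under eq_fun do rewrite expr2; rewrite expr2; apply: cvgM; exact: fc.
  by under eq_fun do rewrite expr2; rewrite expr2; apply: cvgM; exact: pc.
- move=> a x; have /andP[_ h] := in01 a x.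
  by rewrite sqrtr_ge0 -sqrtr1 ler_sqrt.
- move=> a; apply: subset_trans (_ : closure
      ([set x | phi a x != 0] `|` [set x | psi a x != 0]) `<=` _).
    apply: closureS => x /=; rewrite /pou_path.
    have [->|] := eqVneq (phi a x) 0; last by left.
    have [->|] := eqVneq (psi a x) 0; last by right.
    by rewrite expr0n /= !mulr0 addr0 sqrtr0 eqxx.
  by rewrite closureU => x [/fs|/ps].
- move=> x; under eq_bigr => a _.
    rewrite sqr_sqrtr; last by have /andP[] := in01 a x.
    over.
  by rewrite big_split /= -!mulr_sumr f1 p1 !mulr1 subrK.
Qed.

Lemma pou_path0 phi psi : partition_of_unity U phi -> pou_path phi psi 0 = phi.
Proof.
move=> [_ f01 _ _]; apply: funext => a; apply: funext => x.
rewrite /pou_path subr0 mul1r mul0r addr0 sqrtr_sqr ger0_norm //.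
by have /andP[] := f01 a x.
Qed.

Lemma pou_path1 phi psi : partition_of_unity U psi -> pou_path phi psi 1 = psi.
Proof.
move=> [_ f01 _ _]; apply: funext => a; apply: funext => x.
rewrite /pou_path subrr mul1r mul0r add0r sqrtr_sqr ger0_norm //.
by have /andP[] := f01 a x.
Qed.

Lemma sqrt_dist (u v : R) : 0 <= u -> 0 <= v ->
  `|Num.sqrt u - Num.sqrt v| <= Num.sqrt `|u - v|.
Proof.
move=> u0 v0; rewrite -[leLHS]ger0_norm // -sqrtr_sqr ler_sqrt //.
rewrite -[X in _ <= `|X - _|]sqr_sqrtr // -[X in _ <= `|_ - X|]sqr_sqrtr //.
move: (sqrtr_ge0 u) (sqrtr_ge0 v); move: (Num.sqrt u) (Num.sqrt v) => a b a0 b0.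
rewrite subr_sqr normrM expr2 ler_wpM2l //.
by rewrite (ger0_norm (addr_ge0 a0 b0)) ler_norml; apply/andP; split; lra.
Qed.

(** The square root is 1/2-Hoelder, which makes the bound uniform in x. *)
Lemma pou_path_close phi psi s t a x : 0 <= s <= 1 -> 0 <= t <= 1 ->
  partition_of_unity U phi -> partition_of_unity U psi ->
  `|pou_path phi psi s a x - pou_path phi psi t a x| <= Num.sqrt `|s - t|.
Proof.
move=> s01 t01 [_ f01 _ _] [_ p01 _ _].
have f2 := sqr01 (f01 a x); have p2 := sqr01 (p01 a x).
have /andP[hs _] := convex01 s01 f2 p2; have /andP[ht _] := convex01 t01 f2 p2.
apply: le_trans (sqrt_dist hs ht) _; rewrite ler_sqrt //.
move: (phi a x ^+ 2) (psi a x ^+ 2) f2 p2 => u v /andP[u0 u1] /andP[v0 v1].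
rewrite (_ : _ - _ = (s - t) * (v - u)); last by ring.
by rewrite normrM ler_piMr // ler_norml; apply/andP; split; lra.
Qed.

End Path.

Section Supnorm.
Variables (R : realType) (X : Type) (n : nat) (F : X -> 'M[R[i]]_n).

Lemma supnorm_lt c x : (supnorm F < c%:E)%E -> opnorm (F x) < c.
Proof.
move=> Fc; rewrite -lte_fin; apply: le_lt_trans Fc.
by apply: ereal_sup_ubound; right; exists x.
Qed.

Lemma supnorm_le c d : 0 <= c -> c < d -> (forall x, opnorm (F x) <= c) ->
  (supnorm F < d%:E)%E.
Proof.
move=> c0 cd Fc; apply: (@le_lt_trans _ _ c%:E); last by rewrite lte_fin.
apply: ge_ereal_sup => _ [->|[x _ <-]]; first by rewrite lee_fin.
by rewrite lee_fin.
Qed.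

End Supnorm.

(** * Independence of the choices *)

Section Independence.
Variables (R : realType) (X : topologicalType) (L : finType) (U : L -> set X).
Variables (N : nat) (gp gm : L -> L -> X -> 'M[R[i]]_N).
Hypotheses (oU : forall a, open (U a)) (tp : transition_maps U gp)
  (tm : transition_maps U gm).
Hypothesis almost : forall phi x, partition_of_unity U phi ->
  opnorm (Qmx U phi gp gm x - Qmx U phi gp gm x *m Qmx U phi gp gm x) <= 3 / 16.
Local Notation C := R[i].
Local Notation Q phi := (Qmx U phi gp gm).
Local Notation P phi := (rounded U gp gm phi).
#[local] Opaque l2norm opnorm fun_calc.

Lemma opnorm_tri3 n (p q q' p' : 'M[C]_n) :
  opnorm (p - p') <= opnorm (p - q) + opnorm (q - q') + opnorm (p' - q').
Proof.
have -> : p - p' = (p - q) + (q - q') - (p' - q').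
  by rewrite subrKA opprB subrKA.
exact: le_trans (opnormB _ _) (lerD (opnormD _ _) (lexx _)).
Qed.

Lemma opnorm_tri2 n (p q p' : 'M[C]_n) :
  opnorm (p - p') <= opnorm (q - p) + opnorm (p' - q).
Proof.
have -> : p - p' = - (q - p) - (p' - q) by rewrite !opprB subrKA.
by rewrite -(opnormN (q - p)); exact: opnormB.
Qed.

Lemma quarters_lt1 : 4^-1 + 4^-1 + 4^-1 < 1 :> R.
Proof. lra. Qed.

Lemma half_quarter_lt1 (a b : R) : a < 1 / 2 -> b <= 4^-1 -> a + b < 1.
Proof. lra. Qed.

(** Each rounding costs 1/4 and Q moves by at most 1/4 in one step, in total less
    than 1, so that the two projections are conjugate. *)
Lemma rounded_step : exists2 r : R, 0 < r & forall phi psi s t,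
  partition_of_unity U phi -> partition_of_unity U psi ->
  0 <= s <= 1 -> 0 <= t <= 1 -> `|s - t| <= r ->
  conjugate (P (pou_path phi psi s)) (P (pou_path phi psi t)).
Proof.
have e0 : 0 < 4^-1 :> R by rewrite invr_gt0.
have [d d0 H] := qmx_unif e0.
pose tau := d / (2 * #|L|.+1%:R); have tau0 : 0 < tau by rewrite divr_gt0.
(* The path is 1/2-Hoelder in s, hence the square. *)
exists (tau ^+ 2); first by rewrite exprn_gt0.
move=> phi psi s t pf pp s01 t01 st.
have pS := pou_path_pou s01 pf pp; have pT := pou_path_pou t01 pf pp.
apply: conjugate_close; [exact: rounded_projection|exact: rounded_projection|].
move=> x; have cl a : `|pou_path phi psi s a x - pou_path phi psi t a x| <= tau.
  apply: le_trans (pou_path_close a x s01 t01 pf pp) _.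
  have E : Num.sqrt (tau ^+ 2) = tau by rewrite sqrtr_sqr ger0_norm // ltW.
  by rewrite -[leRHS]E ler_sqrt ?sqr_ge0.
have taud : 2 * tau * #|L|%:R <= d.
  rewrite /tau invfM mulrCA [2 * _]mulrA mulfV // mul1r -mulrA ler_piMr ?(ltW d0) //.
  by rewrite mulrC ler_pdivrMr // mul1r ler_nat.
have cp := le_trans (Amx_close (ltW tau0) pS pT tp cl) taud.
have cm := le_trans (Amx_close (ltW tau0) pS pT tm cl) taud.
have QQ := H _ _ _ _ _ (Amx_adj x pS tp) (Amx_adj x pS tm) (Amx_adj x pT tp)
  (Amx_adj x pT tm) (Amx_le1 x pS tp) (Amx_le1 x pS tm) (Amx_le1 x pT tp)
  (Amx_le1 x pT tm) cp cm.
have [_ _ hS] := rounded_facts almost x pS.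
have [_ _ hT] := rounded_facts almost x pT.
apply: le_lt_trans (opnorm_tri3 _ (Q (pou_path phi psi s) x)
  (Q (pou_path phi psi t) x) _) _.
exact: le_lt_trans (lerD (lerD hS QQ) hT) quarters_lt1.
Qed.

Lemma rounded_conjugate phi psi : partition_of_unity U phi ->
  partition_of_unity U psi -> conjugate (P phi) (P psi).
Proof.
move=> pf pp; have [r r0 H] := rounded_step.
have := archi_boundP (ltW (divr_gt0 (@ltr01 R) r0)).
move: (Num.bound _) => n nP.
have n0 : 0 < n%:R :> R by apply: lt_trans nP; rewrite divr_gt0.
have ir : n%:R^-1 <= r by rewrite -[r]invrK lef_pV2 ?posrE ?invr_gt0 // ltW // -div1r.
have k01 k : (k <= n)%N -> 0 <= (k%:R / n%:R : R) <= 1.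
  by move=> kn; rewrite divr_ge0 //= ler_pdivrMr // mul1r ler_nat.
have chain k : (k <= n)%N -> conjugate (P phi) (P (pou_path phi psi (k%:R / n%:R))).
  elim: k => [_|k IH kn].
    rewrite mul0r -{1}(pou_path0 psi pf).
    by apply: H => //; rewrite ?lexx ?ler01 // subrr normr0 ltW.
  apply: conjugate_trans (IH (ltnW kn)) _; apply: H => //; [exact/k01/ltnW|exact: k01|].
  rewrite -mulrBl -natr1 opprD addrA subrr sub0r mulN1r normrN.
  by rewrite ger0_norm // invr_ge0 ltW.
have E : pou_path phi psi (n%:R / n%:R) = psi.
  by rewrite divff ?gt_eqF //; exact: pou_path1 pp.
by have := chain n (leqnn n); rewrite E; apply.
Qed.

Lemma near_conjugate phi (P1 : X -> 'M[C]_(bdim L N + bdim L N)) :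
  partition_of_unity U phi ->
  (supnorm (fun x => Q phi x - P1 x)%R < (1 / 2)%:E)%E ->
  forall x, opnorm (P1 x - P phi x) < 1.
Proof.
move=> pf QP x; have h1 := supnorm_lt x QP.
have [_ _ h2] := rounded_facts almost x pf.
exact: le_lt_trans (opnorm_tri2 _ (Q phi x) _) (half_quarter_lt1 h1 h2).
Qed.

End Independence.

Unset Implicit Arguments.

Theorem theorem9 (R : realType) (m : nat) (hm : (1 <= m)%N) :
  exists eps0 : R, 0 < eps0 /\
  forall eps : R, 0 < eps -> eps < eps0 ->
  forall (X : topologicalType) (L : finType) (U : L -> set X) (N : nat)
    (gp gm : L -> L -> X -> 'M[R[i]]_N),
  compact [set: X] -> hausdorff_space X ->
  #|L| = m -> open_covering U -> (1 <= N)%N ->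
  generalized_pair eps U gp gm ->
  (forall phi : L -> X -> R, partition_of_unity U phi ->
     almost_projection (Qmx U phi gp gm) /\
     exists P : X -> 'M[R[i]]_(bdim L N + bdim L N),
       projection P /\
       (supnorm (fun x => Qmx U phi gp gm x - P x)%R < (1 / 2)%:E)%E) /\
  (forall (phi phi' : L -> X -> R)
     (P P' : X -> 'M[R[i]]_(bdim L N + bdim L N)),
     partition_of_unity U phi -> partition_of_unity U phi' ->
     projection P -> projection P' ->
     (supnorm (fun x => Qmx U phi gp gm x - P x)%R < (1 / 2)%:E)%E ->
     (supnorm (fun x => Qmx U phi' gp gm x - P' x)%R < (1 / 2)%:E)%E ->
     bundle_iso (image_bundle P) (image_bundle P')).
Proof.
have q0 : 0 < 3 / 16 :> R by rewrite divr_gt0.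
have [eps0 eps00 almost0] := qmx_almost_projection q0.
exists eps0; split; first exact: eps00.
move=> eps eps_gt0 eps_lt X L U N gp gm _ _ _ [oU _] _ [tp tm small].
have almost phi x : partition_of_unity U phi ->
    opnorm (Qmx U phi gp gm x - Qmx U phi gp gm x *m Qmx U phi gp gm x) <= 3 / 16.
  move=> pou; rewrite Qmx_qmx.
  have hp := Amx_defect pou (ltW eps_gt0)
    (fun a b c d Ua Ub Uc Ud => (small a b c d x Ua Ub Uc Ud).1).
  have hm' := Amx_defect pou (ltW eps_gt0)
    (fun a b c d Ua Ub Uc Ud => (small a b c d x Ua Ub Uc Ud).2).
  exact: almost0 (Amx_adj x pou tp) (Amx_adj x pou tm) (Amx_le1 x pou tp)
    (Amx_le1 x pou tm) (le_trans hp (ltW eps_lt)) (le_trans hm' (ltW eps_lt)).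
split=> [phi pou|phi phi' P P' pou pou' prP prP' QP QP'].
  split.
    split; first exact: Qmx_continuous.
    apply: (@supnorm_le _ _ _ _ (3 / 16)); [exact: ltW|lra|].
    by move=> x; exact: almost.
  exists (rounded U gp gm phi); split; first exact: rounded_projection.
  apply: (@supnorm_le _ _ _ _ 4^-1); [by rewrite invr_ge0|lra|].
  move=> x; have [_ _ h] := rounded_facts almost x pou.
  by rewrite opnorm_distC.
have PR := rounded_projection oU tp tm almost pou.
have PR' := rounded_projection oU tp tm almost pou'.
apply: conjugate_bundle_iso.
apply: conjugate_trans (conjugate_close prP PR (near_conjugate almost pou QP)) _.
apply: conjugate_trans (rounded_conjugate oU tp tm almost pou pou') _.
apply: (conjugate_close PR' prP') => x; rewrite opnorm_distC.
exact: near_conjugate QP' x.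
Qed.
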